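(* For every $n=1,2,3,\dots$: 1. The Minkowski polynomial $M_{B^n}^{\mathbb{R}^n}$ of the ball $B^n$ is dissipative; moreover all its roots are negative. 2. The Minkowski polynomial $M_{B^n\times 0}^{\mathbb{R}^{n+1}}$ of the squeezed spherical cylinder $B^n\times 0$ is of the form $M_{B^n\times 0}^{\mathbb{R}^{n+1}}(t)=t\cdot D_{B^n\times 0}^{\mathbb{R}^{n+1}}(t)$, where the polynomial $D_{B^n\times 0}^{\mathbb{R}^{n+1}}$ is dissipative. If $n$ is large enough, then the polynomial $M_{B^n\times 0}^{\mathbb{R}^{n+1}}$ has non-real roots. 3. The Minkowski polynomial $M_{Q^n}^{\mathbb{R}^n}$ of the cube $Q^n$ is dissipative; moreover all its roots are negative. 4. The Minkowski polynomial $M_{Q^n\times 0}^{\mathbb{R}^{n+1}}$ of the squeezed cubic cylinder $Q^n\times 0$ is of the form $M_{Q^n\times 0}^{\mathbb{R}^{n+1}}(t)=t\cdot D_{Q^n\times 0}^{\mathbb{R}^{n+1}}(t)$, where the polynomial $D_{Q^n\times 0}^{\mathbb{R}^{n+1}}$ is dissipative; moreover all roots of $D_{Q^n\times 0}^{\mathbb{R}^{n+1}}$ are negative.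
   Context: $B^n=\{x\in\mathbb{R}^n:\sum_{k=1}^n|x_k|^2\le 1\}$ is the unit ball and $Q^n=\{x\in\mathbb{R}^n:\max_{1\le k\le n}|x_k|\le 1\}$ is the unit cube. For $V\subset\mathbb{R}^n$, $V\times 0=\{(x,0):x\in V\}\subset\mathbb{R}^{n+1}$. For a compact convex $V\subset\mathbb{R}^{N}$ the function $t\mapsto \mathrm{Vol}_N(V+tB^N)$, $t\ge 0$, is (Minkowski) a polynomial in $t$ of degree $N$, called the Minkowski polynomial $M_V^{\mathbb{R}^N}(t)$ and considered for all complex $t$. A polynomial is dissipative if all its (complex) roots lie in the open left half-plane $\{z:\mathrm{Re}\,z<0\}$. *)

(* Defs.v *)
From HB Require Import structures.
From mathcomp Require Import all_boot all_order all_algebra.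
From mathcomp Require Import all_classical all_reals all_analysis.
From mathcomp Require Import complex.

Set Implicit Arguments.
Unset Strict Implicit.
Unset Printing Implicit Defensive.
Import Order.TTheory GRing.Theory Num.Theory.
Import numFieldNormedType.Exports.

Local Open Scope classical_set_scope.
Local Open Scope ring_scope.

(* [lebesgue_tuple n] is Lebesgue measure on the Borel sets of R^n, obtained as
   the n-fold product of [lebesgue_measure]: R^0 carries the unit mass at its
   point, and R^(n+1) the image of the product of R and R^n under
   (a, x) |-> a :: x. *)

Section LebesgueCons.
Variables (R : realType) (n : nat).
Local Notation T := (measurableTypeR R).
Variable mu : {sigma_finite_measure set (n.-tuple T) -> \bar R}.

Definition tuple_cons (p : T * n.-tuple T) : n.+1.-tuple T :=
  [tuple of p.1 :: p.2].

Lemma measurable_tuple_cons : measurable_fun setT tuple_cons.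
Proof. exact: measurable_cons. Qed.

HB.instance Definition _ :=
  isMeasurableFun.Build _ _ _ _ tuple_cons measurable_tuple_cons.

Definition lebesgue_cons : set (n.+1.-tuple T) -> \bar R :=
  pushforward (@lebesgue_measure R \x mu)%E tuple_cons.

Let lebesgue_cons0 : lebesgue_cons set0 = 0%E.
Proof. exact: measure0. Qed.

Let lebesgue_cons_ge0 A : (0 <= lebesgue_cons A)%E.
Proof. exact: measure_ge0. Qed.

Let lebesgue_cons_sigma_additive : semi_sigma_additive lebesgue_cons.
Proof. exact: measure_semi_sigma_additive. Qed.

HB.instance Definition _ := isMeasure.Build _ _ _ lebesgue_cons
  lebesgue_cons0 lebesgue_cons_ge0 lebesgue_cons_sigma_additive.

Lemma lebesgue_cons_sigma_finite : sigma_finite setT lebesgue_cons.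
Proof.
have /sigma_finiteP[F [TF ndF Foo]] := sigma_finiteT (@lebesgue_measure R).
have /sigma_finiteP[G [TG ndG Goo]] := sigma_finiteT mu.
pose g (t : n.+1.-tuple T) : T * n.-tuple T := (thead t, [tuple of behead t]).
have gK : cancel tuple_cons g.
  by move=> [a x]; congr pair; apply: val_inj.
have mg : measurable_fun setT g.
  apply/measurable_fun_pair; first exact: measurable_tnth.
  exact: measurable_behead.
exists (fun k => g @^-1` (F k `*` G k)).
  rewrite -preimage_bigcup [X in _ @^-1` X](_ : _ = setT) ?preimage_setT//.
  apply/seteqP; split => // -[x y] _.
  have [k _ Fkx] : (\bigcup_k F k) x by rewrite -TF.
  have [l _ Gly] : (\bigcup_k G k) y by rewrite -TG.
  exists (maxn k l) => //; split.
  - by move: x Fkx; exact/subsetPset/ndF/leq_maxl.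
  - by move: y Gly; exact/subsetPset/ndG/leq_maxr.
move=> k; have [mF F_fin] := Foo k; have [mG G_fin] := Goo k; split.
  by rewrite -[X in measurable X]setTI; apply: mg => //; exact: measurableX.
rewrite /lebesgue_cons /pushforward -comp_preimage.
rewrite (_ : g \o tuple_cons = id); last by apply/funext => p; exact: gK.
by rewrite preimage_id product_measure1E// lte_mul_pinfty// ge0_fin_numE.
Qed.

HB.instance Definition _ := Measure_isSigmaFinite.Build _ _ _ lebesgue_cons
  lebesgue_cons_sigma_finite.

End LebesgueCons.

Fixpoint lebesgue_tuple (R : realType) (n : nat) :
    {sigma_finite_measure set (n.-tuple (measurableTypeR R)) -> \bar R} :=
  match n with
  | 0 => \d_([tuple] : 0.-tuple (measurableTypeR R))
  | m.+1 => lebesgue_cons (lebesgue_tuple R m)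
  end.

Lemma lebesgue_tuple_box (R : realType) (n : nat)
    (A : 'I_n -> set (measurableTypeR R)) :
  (forall i, measurable (A i)) ->
  lebesgue_tuple R n [set t | forall i, A i (tnth t i)] =
  (\prod_(i < n) lebesgue_measure (A i))%E.
Proof.
elim: n A => [|n IHn] A mA.
  by rewrite big_ord0 /= diracE mem_set//= => -[].
rewrite big_ord_recl -(IHn (fun i => A (lift ord0 i)))//.
set B := (X in (_ * lebesgue_tuple R n X)%E).
have mB : measurable B.
  rewrite (_ : B = \bigcap_(i in [set` 'I_n])
      ((fun t => tnth t i) @^-1` A (lift ord0 i))); last first.
    by apply/seteqP; split => t /= Bt i; [move=> _|]; apply: Bt.
  apply: fin_bigcap_measurable => // i _.
  by rewrite -[X in measurable X]setTI; apply: measurable_tnth.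
rewrite -product_measure1E// /= /lebesgue_cons /pushforward.
congr product_measure1; apply/seteqP; split => -[x t] /=.
  move=> h; split => [|i]; first by have := h ord0; rewrite tnth0.
  by have := h (lift ord0 i); rewrite tnthS.
move=> [hx ht] i; case: (unliftP ord0 i) => [j ->|->].
  by rewrite tnthS; exact: ht.
by rewrite tnth0.
Qed.

Section Minkowski.
Variable R : realType.

(* R^n is the type of row vectors; [vol] transports [lebesgue_tuple] along the
   evident bijection with n-tuples. *)
Definition vol (n : nat) (A : set 'rV[R]_n) : \bar R :=
  lebesgue_tuple R n [set t | A (\row_(i < n) tnth t i)].

Definition unit_ball (n : nat) : set 'rV[R]_n :=
  [set x | \sum_(k < n) `|x 0 k| ^+ 2 <= 1].

Definition unit_cube (n : nat) : set 'rV[R]_n :=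
  [set x | \big[Num.max/0]_(k < n) `|x 0 k| <= 1].

(* V x 0 *)
Definition squeezed_cylinder (n : nat) (V : set 'rV[R]_n) :
    set 'rV[R]_(n + 1) :=
  [set row_mx x (0 : 'rV[R]_1) | x in V].

(* V + t B^n *)
Definition parallel_body (n : nat) (V : set 'rV[R]_n) (t : R) :
    set 'rV[R]_n :=
  [set x + t *: b | x in V & b in @unit_ball n].

Definition is_minkowski_poly (n : nat) (V : set 'rV[R]_n) (M : {poly R}) :=
  forall t : R, 0 <= t -> vol (parallel_body V t) = (M.[t])%:E.

(* Junk value 0 when the volume of V + t B^n is not polynomial in t >= 0. *)
Definition minkowski_poly (n : nat) (V : set 'rV[R]_n) : {poly R} :=
  xget 0 [set M | is_minkowski_poly V M].

Lemma minkowski_polyE (n : nat) (V : set 'rV[R]_n) (M : {poly R}) :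
  is_minkowski_poly V M -> minkowski_poly V = M.
Proof.
move=> hM; rewrite /minkowski_poly; case: xgetP => [N _ hN|/(_ M)//].
apply/eqP; rewrite -subr_eq0; apply/negPn/negP => D0.
pose s := [seq i%:R | i <- iota 0 (size (N - M))] : seq R.
have us : uniq s.
  by rewrite map_inj_uniq ?iota_uniq// => i j /eqP; rewrite eqr_nat => /eqP.
have rs : all (root (N - M)) s.
  apply/allP => _ /mapP[i _ ->]; rewrite rootE hornerD hornerN subr_eq0.
  by apply/eqP/EFin_inj; rewrite -hN// -hM.
by have := max_poly_roots D0 rs us; rewrite size_map size_iota ltnn.
Qed.

Definition complex_root (p : {poly R}) (z : R[i]) : bool :=
  root (map_poly (real_complex R) p) z.

Definition dissipative (p : {poly R}) : Prop :=
  forall z : R[i], complex_root p z -> complex.Re z < 0.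

Definition all_roots_negative (p : {poly R}) : Prop :=
  forall z : R[i], complex_root p z -> complex.Im z = 0 /\ complex.Re z < 0.

Definition has_nonreal_root (p : {poly R}) : Prop :=
  exists z : R[i], complex_root p z /\ complex.Im z <> 0.

End Minkowski.

Arguments unit_ball R n : clear implicits.
Arguments unit_cube R n : clear implicits.

(* Main.v *)
Require Import Defs.
From mathcomp Require Import all_boot all_order all_algebra.
From mathcomp Require Import all_classical all_reals all_analysis.
From mathcomp Require Import measurable_realfun complex ring lra.

(** Let kappa_n be the volume of the unit ball of dimension n, and w_k =
    kappa_(k+1) / kappa_k, which by slicing is the integral of (1 - u^2)^(k/2)
    over [-1, 1].

    Volumes. For a box with half-sides c_i >= 0 the parallel body of radius t
    consists of the points whose distances to the intervals [-c_i, c_i] have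
    squares summing to at most t^2. Slicing along the first coordinate turns
    the volume polynomial p of the remaining coordinates into 2 c p + S p,
    where S maps X^k to w_k X^(k+1) ([lebesgue_box_nbhd]). All c_i = 0 gives
    the ball of radius t, kappa_n X^n, hence kappa_n (1 + X)^n for the parallel
    body of the unit ball; c_i = 1 gives the cube, the sum of C(n, k) 2^(n-k)
    kappa_k X^k; one further c_i = 0 gives the squeezed cube, the sum of C(n,
    k) 2^(n-k) kappa_(k+1) X^(k+1) ([box_poly_cube]). The squeezed ball, sliced
    along its thin direction, has slices that are balls of radius 1 + sqrt (t^2
    - s^2), so its polynomial is kappa_n S (1 + X)^n, that is, kappa_n X times
    the sum of C(n, k) w_k X^k ([squeezed_ball_polyE]).

    Ball. The only root is -1.

    Cube and squeezed cube. The sequence kappa_k is, up to a geometric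
    progression, a limit of polynomials in k with negative zeros: from kappa_k
    = const (k + 2) kappa_(k+2) one gets kappa_k = const^m (k + 2) ... (k + 2m)
    kappa_(k+2m), and kappa_(k+2m) is asymptotically geometric in k since
    w_(M+1) / w_M tends to 1. Multiplying the k-th coefficient by k + c, c > 0,
    preserves the property of having only negative roots (Laguerre,
    [all_roots_negative_Laguerre]). Starting from (2 + l X)^n, the Steiner
    polynomials are thus limits of polynomials with only negative roots. For
    those |p(z)| >= |lead p| |Im z|^n, and this bound passes to the limit; a
    real-rooted polynomial with positive coefficients has only negative roots
    ([steiner_poly_all_roots_negative]).

    Squeezed ball, dissipativity. Let D be the sum of C(n, k) w_k X^k, and let
    moment be the functional sending X^k to w_k. Integration by parts shows
    that moment q' > 0 whenever q(x) < q(1) on [0, 1) ([moment_deriv_gt0]). If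
    D(z) = 0 and Re z >= 0, the polynomial q(x) = Re (conj (1 + z)^(n+1) (1 + z
    x)^(n+1)) satisfies the hypothesis because |1 + z x| < |1 + z|, while
    moment q' is a multiple of Re (conj (1 + z)^(n+1) z D(z)) = 0, a
    contradiction.

    Squeezed ball, non-real roots. If D were real-rooted, the sum of the
    squares of the reciprocals of its roots would be nonnegative, that is n
    w_1^2 >= (n - 1) w_0 w_2; but w_1^2 < w_0 w_2 by Cauchy-Schwarz, so this
    fails for n large ([ball_poly_nonreal_root]). *)

Set Implicit Arguments.
Unset Strict Implicit.
Unset Printing Implicit Defensive.
Import Order.TTheory GRing.Theory Num.Theory.
Import numFieldNormedType.Exports ComplexField.Normc.

Local Open Scope classical_set_scope.
Local Open Scope ring_scope.

Section MinkowskiPolynomials.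
Variable R : realType.
Implicit Types (p q : {poly R}) (z : R[i]).
Notation toC := (real_complex R).
Notation Re := (@complex.Re R).
Notation Im := (@complex.Im R).
Notation mu := (@lebesgue_measure R).
Notation T := (measurableTypeR R).
Notation leb := (lebesgue_tuple R).

(** * Complex roots of real polynomials *)

Lemma complex_eta z : z = Complex (Re z) (Im z). Proof. by case: z. Qed.

Lemma normc_exp z k : normc (z ^+ k) = normc z ^+ k.
Proof.
elim: k => [|i IH]; last by rewrite !exprS normcM IH.
by rewrite /= expr0n expr1n addr0 sqrtr1.
Qed.

Lemma normc_sum I (r : seq I) (F : I -> R[i]) :
  normc (\sum_(i <- r) F i) <= \sum_(i <- r) normc (F i).
Proof.
elim: r => [|i r IH]; first by rewrite !big_nil normc0.
by rewrite !big_cons (le_trans (le_normcD _ _))// lerD2l.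
Qed.

Lemma normc_real (x : R) : normc x%:C%C = `|x|.
Proof. by rewrite /= expr0n addr0 sqrtr_sqr. Qed.

Lemma normc_horner_le n (E : nat -> R) z :
  normc (map_poly toC (\poly_(k < n) E k)).[z] <=
    \sum_(k < n) `|E k| * normc z ^+ k.
Proof.
have -> : map_poly toC (\poly_(k < n) E k) = \poly_(k < n) (E k)%:C%C.
  apply/polyP => k; rewrite coef_map !coef_poly.
  by case: ifP => // _; rewrite rmorph0.
rewrite horner_poly; apply: le_trans (normc_sum _ _) _.
by apply: ler_sum => k _; rewrite normcM normc_real normc_exp.
Qed.

Lemma Re_sum I (r : seq I) (F : I -> R[i]) :
  Re (\sum_(i <- r) F i) = \sum_(i <- r) Re (F i).
Proof.
elim: r => [|i r IH]; first by rewrite !big_nil.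
by rewrite !big_cons -IH; case: (F i) (\sum_(j <- r) F j) => [a b] [c d].
Qed.

Lemma Re_mul_real z (x : R) : Re (z * x%:C%C) = Re z * x.
Proof. by case: z => a b /=; rewrite mulr0 subr0. Qed.

Lemma Re_le_normc z : Re z <= normc z.
Proof.
case: z => a b /=; apply: le_trans (ler_norm a) _.
by rewrite -sqrtr_sqr ler_wsqrtr// lerDl sqr_ge0.
Qed.

Lemma normc_conj z : normc (conjc z) = normc z.
Proof. by case: z => a b /=; rewrite sqrrN. Qed.

Lemma normc_ge0 z : 0 <= normc z.
Proof. by case: z => a b /=; rewrite sqrtr_ge0. Qed.

Lemma complex_rootZ a p z : a != 0 -> complex_root (a *: p) z = complex_root p z.
Proof. by move=> a0; rewrite /complex_root map_polyZ rootZ// fmorph_eq0. Qed.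

Lemma all_roots_negative_dissipative p :
  all_roots_negative p -> dissipative p.
Proof. by move=> h z /h[]. Qed.

Lemma real_rooted_factor p : (forall z, complex_root p z -> Im z = 0) ->
  exists rs : seq R, p = lead_coef p *: \prod_(r <- rs) ('X - r%:P).
Proof.
move=> hp.
have [-> | p0] := eqVneq p 0; first by exists [::]; rewrite lead_coef0 scale0r.
have [zs Ep] := closed_field_poly_normal (map_poly toC p).
exists (map Re zs).
apply: (@map_poly_inj _ _ toC).
rewrite [LHS]Ep lead_coef_map map_polyZ rmorph_prod big_map.
congr (_ *: _); rewrite big_seq [RHS]big_seq; apply: eq_bigr => z zzs.
rewrite rmorphB /= map_polyX map_polyC /=; congr (_ - _%:P).
have /hp : complex_root p z.
  rewrite /complex_root Ep rootZ ?lead_coef_eq0 ?map_poly_eq0//.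
  by rewrite root_prod_XsubC.
by case: z {zzs} => x y /= ->.
Qed.

Lemma complex_root_prod (c : R) (rs : seq R) z : c != 0 ->
  complex_root (c *: \prod_(r <- rs) ('X - r%:P)) z ->
  exists2 r, r \in rs & z = r%:C%C.
Proof.
move=> c0; rewrite /complex_root map_polyZ rootZ ?fmorph_eq0//.
rewrite rmorph_prod /=.
under eq_bigr do rewrite rmorphB /= map_polyX map_polyC /=.
rewrite -(big_map toC xpredT (fun a => 'X - a%:P)) root_prod_XsubC.
by case/mapP => r rrs ->; exists r.
Qed.

Lemma complex_rootE p r : complex_root p r%:C%C = root p r.
Proof. by rewrite /complex_root fmorph_root. Qed.

Lemma all_roots_negative_factor p : p != 0 -> all_roots_negative p ->
  exists rs : seq R, p = lead_coef p *: \prod_(r <- rs) ('X - r%:P) /\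
    all (fun r => r < 0) rs.
Proof.
move=> p0 hp; have [z /hp[]//|rs Ep] := @real_rooted_factor p.
exists rs; split => //; apply/allP => r rrs.
have /hp[] // : complex_root p r%:C%C.
by rewrite complex_rootE Ep rootZ ?lead_coef_eq0// root_prod_XsubC.
Qed.

(** For non-real z this is the half plane on the side of z, closed up by the
    nonnegative reals only; for real z it is the nonnegative half-line. It is a
    convex cone, and z / (z - r) lies in it for every r < 0 unless z is a
    negative real. Adding a positive constant never gives 0 inside it, which is
    what excludes roots. *)
Definition sector z : pred R[i] := fun s =>
  (0 <= Im s * Im z) && ((Im s * Im z == 0) ==> (Im s == 0) && (0 <= Re s)).

Lemma sector0 z : sector z 0.
Proof. by rewrite /sector /= mul0r !lexx !eqxx. Qed.

Lemma sectorD z s t : sector z s -> sector z t -> sector z (s + t).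
Proof.
case: s t z => [s1 s2] [t1 t2] [x y]; rewrite /sector /=.
move=> /andP[h1 h2] /andP[h3 h4]; rewrite mulrDl addr_ge0//=.
apply/implyP; rewrite paddr_eq0// => /andP[e1 e2].
move: h2 h4; rewrite e1 e2 /= => /andP[/eqP-> a] /andP[/eqP-> b].
by rewrite addr0 eqxx addr_ge0.
Qed.

Lemma sector_frac z r : r < 0 -> (Im z = 0 -> 0 <= Re z) ->
  sector z (z / (z - r%:C%C)).
Proof.
case: z => [x y] /= r0 hz; rewrite /sector.
have -> : (x +i* y)%C / ((x +i* y)%C - r%:C%C) =
  (((x * (x - r) + y ^+ 2) / ((x - r) ^+ 2 + y ^+ 2)) +i*
   ((- r * y) / ((x - r) ^+ 2 + y ^+ 2)))%C.
  apply/eqP; rewrite eq_complex /=; apply/andP; split; apply/eqP.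
    by rewrite -/(_^-1) ?subr0 ?oppr0 ?addr0; ring.
  by rewrite -/(_^-1) ?subr0 ?oppr0 ?addr0; ring.
have d0 : 0 < (x - r) ^+ 2 + y ^+ 2.
  have [y0|y0] := eqVneq y 0.
    by rewrite y0 expr0n addr0 exprn_gt0// subr_gt0 (lt_le_trans r0)// hz.
  by rewrite ltr_wpDl ?sqr_ge0// lt0r sqr_ge0 sqrf_eq0 y0.
have -> : - r * y / ((x - r) ^+ 2 + y ^+ 2) * y =
    - r * (y ^+ 2 / ((x - r) ^+ 2 + y ^+ 2)) by ring.
have h : 0 <= - r * (y ^+ 2 / ((x - r) ^+ 2 + y ^+ 2)).
  by apply: mulr_ge0; [lra|rewrite divr_ge0 ?sqr_ge0 ?(ltW d0)].
rewrite h /=; apply/implyP.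
rewrite !mulf_eq0 invr_eq0 (gt_eqF d0) orbF oppr_eq0 (lt_eqF r0) /= orbb.
move=> /eqP y0; rewrite y0 eqxx /= expr0n !addr0 divr_ge0 ?sqr_ge0//.
by have := hz y0; nra.
Qed.

(** The logarithmic derivative z P'(z) / P(z) is the sum of the z / (z - r)
    over the roots r. The product form avoids dividing by P(z). *)
Lemma log_derivative_in_sector (rs : seq R) z : all (fun r => r < 0) rs ->
  (Im z = 0 -> 0 <= Re z) ->
  exists2 s, sector z s &
    z * (map_poly toC (\prod_(r <- rs) ('X - r%:P)))^`().[z] =
    s * (map_poly toC (\prod_(r <- rs) ('X - r%:P))).[z].
Proof.
move=> + hz; elim: rs => [_|r rs IH /= /andP[r0 /IH[s hs Es]]].
  exists 0; first exact: sector0.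
  by rewrite big_nil rmorph1 derivC horner0 mul0r mulr0.
have zr : z - r%:C%C != 0.
  rewrite subr_eq0; apply: contraTneq r0 => zr.
  by rewrite -leNgt; have := hz; rewrite zr /=; apply.
exists (z / (z - r%:C%C) + s); first by rewrite sectorD// sector_frac.
rewrite big_cons rmorphM rmorphB /= map_polyX map_polyC derivM.
rewrite derivB derivX derivC subr0 mul1r hornerD !hornerM hornerXsubC.
set P := _.[z] in Es *; set P' := _.[z] in Es *.
have aux (a b c d w : R[i]) : w != 0 -> a * b = c * d ->
    a * (d + w * b) = (a / w + c) * (w * d).
  by move=> w0 E; rewrite mulrDr mulrDl (mulrCA a) E (mulrCA c) mulrA divfK.
exact: aux.
Qed.

(** Laguerre: the operator multiplying the coefficient of X^k by k + c keeps
    the roots in the negative half-line, because at a root z outside it z P'(z)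
    / P(z) + c would vanish, while the first term lies in [sector z] and c > 0.
    *)
Lemma all_roots_negative_Laguerre p (c : R) : p != 0 -> 0 < c ->
  all_roots_negative p -> all_roots_negative ('X * p^`() + c *: p).
Proof.
move=> p0 c0 hp; have [rs [Ep neg]] := all_roots_negative_factor p0 hp.
have lc0 : lead_coef p != 0 by rewrite lead_coef_eq0.
suff key z : (Im z = 0 -> 0 <= Re z) ->
    ~~ complex_root ('X * p^`() + c *: p) z.
  move=> z rz; have [Iz|Iz] := eqVneq (Im z) 0.
    split => //; rewrite ltNge; apply/negP => Rz.
    by move: rz; apply/negP/key.
  by exfalso; move: rz; apply/negP/key => /eqP; rewrite (negPf Iz).
move=> hz; have [s hs Es] := log_derivative_in_sector neg hz.
rewrite /complex_root rootE rmorphD rmorphM /= map_polyX map_polyZ.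
rewrite -deriv_map Ep !map_polyZ derivZ /= hornerD hornerM hornerX !hornerZ.
move: Es; set P := (map_poly _ (\prod_(_ <- _) _)).
have aux (a b d l k : R[i]) : a * b = s * d ->
    a * (l * b) + k * (l * d) = l * ((s + k) * d).
  by move=> E; rewrite (mulrCA a) E (mulrCA k) -mulrDr -mulrDl.
move=> /aux ->; rewrite !mulf_eq0 fmorph_eq0 (negPf lc0) /=.
rewrite negb_or; apply/andP; split.
  case: s {aux} hs => s1 s2; rewrite eq_complex /= addr0 /sector /= => hs.
  apply/negP => /andP[/eqP e1 /eqP e2].
  by move: hs; rewrite e2 mul0r lexx !eqxx /=; lra.
apply/negP => /eqP Pz.
have [|r rrs zr] := @complex_root_prod 1 rs z (oner_neq0 _).
  by rewrite /complex_root scale1r rootE -/P Pz.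
by have := allP neg r rrs; move: hz; rewrite zr /= => /(_ erefl); lra.
Qed.

Lemma normc_ge_Im z : `|Im z| <= normc z.
Proof.
case: z => x y /=; rewrite -sqrtr_sqr ler_wsqrtr//.
by rewrite lerDr sqr_ge0.
Qed.

(** Each factor |z - r| with r real is at least |Im z|. This quantitative form
    of real-rootedness passes to limits of polynomials with a fixed degree. *)
Lemma normc_ge_Im_pow p z : all_roots_negative p -> p != 0 ->
  `|lead_coef p| * `|Im z| ^+ (size p).-1 <=
    normc (map_poly toC p).[z].
Proof.
move=> hp p0; have [rs [Ep _]] := all_roots_negative_factor p0 hp.
have lc0 : lead_coef p != 0 by rewrite lead_coef_eq0.
have -> : (size p).-1 = size rs.
  by rewrite Ep size_scale// size_prod_XsubC.
rewrite {2}Ep map_polyZ hornerZ normcM.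
have -> : normc (toC (lead_coef p)) = `|lead_coef p|.
  by rewrite /= expr0n addr0 sqrtr_sqr.
rewrite ler_wpM2l// {Ep}; elim: rs => [|r rs IH].
  by rewrite big_nil rmorph1 hornerC /= expr0n expr1n addr0 sqrtr1 expr0.
rewrite big_cons rmorphM hornerM normcM exprS.
rewrite ler_pM ?exprn_ge0// rmorphB /= map_polyX map_polyC hornerXsubC.
by have := normc_ge_Im (z - r%:C%C); rewrite {1}(complex_eta z) /= oppr0 addr0.
Qed.

(** For p = a (1 + c_1 X) (1 + c_2 X) ..., with p(0) <> 0, this is the
    nonnegativity of the sum of the c_i ^ 2, a weak form of Newton's
    inequality. *)
Lemma real_rooted_coef012 p : (forall z, complex_root p z -> Im z = 0) ->
  2 * p`_0 * p`_2 <= p`_1 ^+ 2.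
Proof.
move=> /real_rooted_factor[rs ->]; move: (lead_coef p) => c.
rewrite !coefZ.
suff : 2 * (\prod_(r <- rs) ('X - r%:P))`_0 * (\prod_(r <- rs) ('X - r%:P))`_2
    <= (\prod_(r <- rs) ('X - r%:P))`_1 ^+ 2.
  set a := _`_0; set b := _`_2; set d := _`_1 => h.
  have := sqr_ge0 c; nra.
elim: rs => [|r rs]; first by rewrite big_nil !coefC /=; lra.
rewrite big_cons; set q := \prod_(_ <- _) _ => IH.
rewrite !mulrBl !coefB !coefXM /= !coefCM.
by have := sqr_ge0 r; have := sqr_ge0 q`_0; nra.
Qed.

(** * Integrals of powers of the height of the half circle *)

Lemma continuous_integrable (f : R -> R) (a b : R) : continuous f ->
  mu.-integrable `[a, b] (EFin \o f).
Proof.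
move=> cf; apply: continuous_compact_integrable; first exact: segment_compact.
exact: continuous_subspaceT.
Qed.

(** The mean value theorem for x |-> int_0^x f - F x. It compares an integral
    with the increment of F from the sign of f - F' alone, and F' may be
    unbounded near the endpoints, as happens with square roots. *)
Lemma integral_sub_primitive (f F dF : R -> R) :
  continuous f -> continuous F ->
  (forall x : R, x \in `]0, 1[%R -> is_derive x 1 F (dF x)) ->
  exists2 c, c \in `]0, 1[%R &
    \int[mu]_(x in `[0, 1]) f x - (F 1 - F 0) = f c - dF c.
Proof.
move=> cf cF dFE.
pose I b := \int[mu]_(x in `[0, b]) f x.
have i01 : mu.-integrable `[0, 1] (EFin \o f) by exact: continuous_integrable.
have [] := @MVT R (fun x => I x - F x) (fun x => f x - dF x) 0 1 ltr01.
- move=> x x01; apply: is_deriveB; last exact: dFE.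
  move: x01; rewrite in_itv /= => /andP[x0 x1].
  have [dI <-] := @continuous_FTC1_closed R f 0 x 1 x1 i01 x0 (cf x).
  by rewrite derive1E; apply/derivableP.
- move=> x; apply: (@continuousB _ _ _ (I : subspace `[0, 1] -> R) F).
    exact: parameterized_integral_continuous.
  exact: continuous_subspaceT.
- move=> c c01; rewrite subr0 mulr1 => E; exists c => //; rewrite -E.
  have -> : I 0 = 0 by rewrite /I set_itv1 Rintegral_set1.
  by rewrite sub0r opprK -/(I 1) opprB addrA addrAC.
Qed.

Definition circle_height (u : R) : R := Num.sqrt (1 - u ^+ 2).

Lemma continuous_circle_height : continuous circle_height.
Proof.
move=> u; apply: (@continuous_comp R R R (fun u => 1 - u ^+ 2) Num.sqrt).
  by apply: continuousB; [exact: cvg_cst|exact: exprn_continuous].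
exact: sqrt_continuous.
Qed.

Lemma circle_height0 : circle_height 0 = 1.
Proof. by rewrite /circle_height expr0n subr0 sqrtr1. Qed.

Lemma circle_height1 : circle_height 1 = 0.
Proof. by rewrite /circle_height expr1n subrr sqrtr0. Qed.

Lemma circle_height_ge0 u : 0 <= circle_height u. Proof. exact: sqrtr_ge0. Qed.

Lemma circle_height_le1 u : circle_height u <= 1.
Proof. by rewrite /circle_height -[leRHS]sqrtr1 ler_wsqrtr// lerBlDr lerDl sqr_ge0. Qed.

Lemma sqr_circle_height u : u \in `[0, 1] -> circle_height u ^+ 2 = 1 - u ^+ 2.
Proof.
rewrite in_itv /= => /andP[u0 u1]; rewrite sqr_sqrtr// subr_ge0.
by rewrite expr_le1.
Qed.

Lemma circle_height_gt0 (u : R) : u \in `]0, 1[%R -> 0 < circle_height u.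
Proof.
rewrite in_itv /= => /andP[u0 u1]; rewrite sqrtr_gt0 subr_gt0.
by rewrite expr_lt1// ltW.
Qed.

Lemma is_derive_circle_height (u : R) : u \in `]0, 1[%R ->
  is_derive u 1 circle_height (- (u / circle_height u)).
Proof.
move=> u01; have a0 := circle_height_gt0 u01.
have d1 : is_derive u 1 (fun u : R => 1 - u ^+ 2) (- (2 * u)).
  by apply: is_derive_eq; rewrite ?sub0r /GRing.scale /=; ring.
have d2 : is_derive (1 - u ^+ 2) 1 Num.sqrt (2 * circle_height u)^-1.
  by apply: is_derive1_sqrt; rewrite -sqrtr_gt0.
have -> : - (u / circle_height u) = (2 * circle_height u)^-1 * - (2 * u).
  by field; rewrite !gt_eqF.
exact: (@is_derive1_comp _ Num.sqrt (fun u : R => 1 - u ^+ 2)).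
Qed.

(** In a ball of radius 1 of dimension k.+1, the slice at height u is a ball of
    dimension k and radius [circle_height u], so this is the ratio of the
    volumes of the unit balls of dimensions k.+1 and k. It is locked to keep
    rewriting from looking inside the product. *)
Definition wallis k : R :=
  locked (2 * \int[mu]_(u in `[0, 1]) circle_height u ^+ k).

(** The integral of p(circle_height u) over [-1, 1] ([moment_wallis]), given by
    coefficients so that the study of roots involves no integral. *)
Definition moment p : R := \sum_(k < size p) p`_k * wallis k.

Lemma momentE n p : (size p <= n)%N -> moment p = \sum_(k < n) p`_k * wallis k.
Proof.
move=> le; rewrite /moment (big_ord_widen n (fun k => p`_k * wallis k))// big_mkcond.
apply: eq_bigr => k _; case: ltnP => // h.
by rewrite nth_default// mul0r.
Qed.

Lemma size_deriv_le p n : (size p <= n.+1)%N -> (size p^`() <= n)%N.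
Proof.
move=> sp; apply/leq_sizeP => j nj.
by rewrite coef_deriv nth_default ?mul0rn// (leq_trans sp).
Qed.

Lemma continuous_horner_circle_height p : continuous (fun u => p.[circle_height u]).
Proof.
move=> u; apply: (@continuous_comp R R R circle_height (horner p)).
  exact: continuous_circle_height.
exact: continuous_horner.
Qed.

Lemma continuous_circle_heightX k : continuous (fun u => circle_height u ^+ k).
Proof.
have := @continuous_horner_circle_height 'X^k.
by under [X in continuous X]eq_fun do rewrite hornerXn.
Qed.

Lemma moment_wallis p : moment p =
  2 * \int[mu]_(u in `[0, 1]) p.[circle_height u].
Proof.
rewrite /moment.
have -> : (fun u => p.[circle_height u]) =
    fun u => \sum_(k < size p) p`_k * circle_height u ^+ k.
  by apply/funext => u; rewrite horner_coef.
elim: (size p) => [|n IH].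
  rewrite big_ord0 (_ : (fun u => _) = cst 0) ?Rintegral_cst ?mul0r ?mulr0//.
  by apply/funext => u; rewrite big_ord0.
rewrite big_ord_recr /= IH.
have -> : (fun u => \sum_(k < n.+1) p`_k * circle_height u ^+ k) =
   (fun u => \sum_(k < n) p`_k * circle_height u ^+ k + p`_n * circle_height u ^+ n).
  by apply/funext => u; rewrite big_ord_recr.
rewrite RintegralD//.
- rewrite RintegralZl//; last exact/continuous_integrable/continuous_circle_heightX.
  by rewrite mulrDr /wallis -lock mulrCA.
- apply: continuous_integrable => u; apply: cvg_big => [|k _].
    exact: add_continuous.
  by apply: cvgM; [exact: cvg_cst|exact: continuous_circle_heightX].
- apply: continuous_integrable => u.
  by apply: cvgM; [exact: cvg_cst|exact: continuous_circle_heightX].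
Qed.

(** The functional q |-> moment q' is integration of q(1) - q against the
    positive measure 2 dt / cos^2 t, where x = sin t, by parts. In the variable
    u = cos t this is done with F(u) = (q(1) - q(x)) x / u, where x =
    circle_height u; writing q - q(1) = s (X - 1), one has F(u) = s(x) x u / (1
    + x), which is continuous and vanishes at both ends, and F'(u) = q'(x) -
    s(x) / (x (1 + x)) < q'(x). *)
Lemma moment_deriv_gt0 q :
  (forall x, 0 <= x < 1 -> q.[x] < q.[1]) -> 0 < moment q^`().
Proof.
move=> hq.
have /factor_theorem[s] : root (q - q.[1]%:P) 1.
  by rewrite rootE hornerD hornerN hornerC subrr.
rewrite polyC1 => Es.
have qE x : q.[x] = q.[1] + s.[x] * (x - 1).
  have := congr1 (fun p : {poly R} => p.[x]) Es.
  by rewrite hornerM !hornerD !hornerN !hornerC hornerX => <-; rewrite addrC subrK.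
have q'E : q^`() = s^`() * ('X - 1) + s.
  have := congr1 (fun p : {poly R} => p^`()) Es.
  by rewrite derivM !derivB derivX derivC !subr0 derivC subr0 mulr1.
have s_gt0 x : 0 <= x < 1 -> 0 < s.[x].
  by move=> x01; have := hq x x01; rewrite qE; move/andP: x01 => [_ x1]; nra.
(* The factor u / (1 + x) is (1 - x) / u, regular at u = 0. *)
pose F u := (s * 'X).[circle_height u] * (u / (1 + circle_height u)).
pose dF u := q^`().[circle_height u] -
  s.[circle_height u] / (circle_height u * (1 + circle_height u)).
have a1_gt0 u : 0 < 1 + circle_height u by rewrite ltr_pwDl// circle_height_ge0.
have cF : continuous F.
  move=> u; apply: cvgM; first exact: continuous_horner_circle_height.
  apply: cvgM; first exact: cvg_id.
  apply: cvgV; first by rewrite gt_eqF.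
  by apply: cvgD; [exact: cvg_cst|exact: continuous_circle_height].
have dFE (u : R) : u \in `]0, 1[%R -> is_derive u 1 F (dF u).
  move=> u01; have da := is_derive_circle_height u01; have a_gt0 := circle_height_gt0 u01.
  have d1 := @is_derive1_comp R (horner (s * 'X)) circle_height u
    _ _ (is_derive_poly _ _) da.
  have d2 : is_derive u 1 (fun u => 1 + circle_height u) (- (u / circle_height u)).
    by apply: is_derive_eq; ring.
  have d3 : is_derive u 1 (fun u => (1 + circle_height u)^-1)
      (- (1 + circle_height u) ^- 2 *: - (u / circle_height u)).
    by apply: is_deriveV; apply: lt0r_neq0.
  have d4 := is_deriveM d1 (is_deriveM (is_derive_id u 1) d3).
  suff -> : dF u = (horner (s * 'X) \o circle_height) u *: (id u *:
      (- (1 + circle_height u) ^- 2 *: - (u / circle_height u)) +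
      (1 + circle_height u)^-1 *: 1) +
      (id * (fun u => (1 + circle_height u)^-1)) u *:
      ((s * 'X)^`().[circle_height u] * - (u / circle_height u)) by exact: d4.
  have u2 := sqr_circle_height (subset_itv_oo_cc u01).
  rewrite /dF q'E derivM derivX !(hornerD, hornerM, hornerX, hornerN, hornerC) /=.
  rewrite !fctE.
  rewrite /GRing.scale /=; move: u2 a_gt0 (a1_gt0 u).
  rewrite hornerM hornerX.
  move: (circle_height u) => a u2 a0 a1; move: (s.[a]) (s^`().[a]) => S S'.
  have {}u2 : u ^+ 2 = 1 - a ^+ 2 by rewrite u2; ring.
  transitivity (S * a * (u ^+ 2 / (a * (1 + a) ^+ 2) + (1 + a)^-1)
      - (S' * a + S) * (u ^+ 2 / (a * (1 + a)))).
    by rewrite u2; field; rewrite !gt_eqF.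
  by field; rewrite !gt_eqF.
rewrite moment_wallis mulr_gt0//.
have [c c01 Ec] := @integral_sub_primitive (fun u => q^`().[circle_height u]) F dF
  (@continuous_horner_circle_height _) cF dFE.
have F10 : F 1 - F 0 = 0.
  by rewrite /F circle_height1 circle_height0 hornerM hornerX !mulr0 !mul0r !mulr0 subr0.
move: Ec; rewrite F10 subr0 => ->.
rewrite /dF opprB addrC subrK divr_gt0 ?mulr_gt0 ?a1_gt0 ?circle_height_gt0//.
apply: s_gt0; rewrite circle_height_ge0/= /circle_height -[ltRHS]sqrtr1 ltr_sqrt//.
move: c01; rewrite in_itv /= => /andP[c0 c1].
by rewrite ltrBlDr ltrDl exprn_gt0.
Qed.

Lemma wallis_gt0 k : 0 < wallis k.
Proof.
rewrite /wallis -lock.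
have := @moment_deriv_gt0 (k.+1%:R^-1 *: 'X^(k.+1)).
rewrite derivZ derivXn -scalerMnr scalerMnl -[_^-1 *+ _]mulr_natl.
rewrite divff ?pnatr_eq0// scale1r.
rewrite moment_wallis; under eq_Rintegral do rewrite hornerXn.
apply=> x /andP[x0 x1]; rewrite !hornerZ !hornerXn expr1n ltr_pM2l ?invr_gt0//.
by rewrite expr_lt1.
Qed.

#[local] Hint Resolve wallis_gt0 : core.

Lemma wallis_noninc k : wallis k.+1 <= wallis k.
Proof.
rewrite /wallis -!lock ler_pM2l//; apply: le_Rintegral => //.
- exact/continuous_integrable/continuous_circle_heightX.
- exact/continuous_integrable/continuous_circle_heightX.
- by move=> x _; rewrite exprS ler_piMl ?circle_height_le1// exprn_ge0 ?circle_height_ge0.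
Qed.

(** Integration of the derivative of u x^(k+2), x = circle_height u, which
    vanishes at 0 and 1. *)
Lemma wallis_rec k : k.+3%:R * wallis k.+2 = k.+2%:R * wallis k.
Proof.
pose F u := u * circle_height u ^+ k.+2.
pose f u := k.+3%:R * circle_height u ^+ k.+2 - k.+2%:R * circle_height u ^+ k.
have cZ j (a : R) : continuous (fun u => a * circle_height u ^+ j).
  by move=> u; apply: cvgM; [exact: cvg_cst|exact: continuous_circle_heightX].
have cf : continuous f by move=> u; apply: cvgB; apply: cZ.
have cF : continuous F.
  by move=> u; apply: cvgM; [exact: cvg_id|exact: continuous_circle_heightX].
have dFE (u : R) : u \in `]0, 1[%R -> is_derive u 1 F (f u).
  move=> u01; have da := is_derive_circle_height u01; have a_gt0 := circle_height_gt0 u01.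
  have d1 := @is_derive1_comp R (horner 'X^(k.+2)) circle_height u
    _ _ (is_derive_poly _ _) da.
  have d2 := is_deriveM (is_derive_id u 1) d1.
  have -> : F = id * (horner 'X^(k.+2) \o circle_height).
    by apply/funext => v; rewrite /F !fctE /= hornerXn.
  suff -> : f u = id u *: (('X^(k.+2))^`().[circle_height u] * - (u / circle_height u)) +
      (horner 'X^(k.+2) \o circle_height) u *: 1 by exact: d2.
  have u2 := sqr_circle_height (subset_itv_oo_cc u01).
  have {}u2 : u ^+ 2 = 1 - circle_height u ^+ 2 by rewrite u2; ring.
  rewrite /f derivXn hornerMn /= !hornerXn /GRing.scale /= mulr1 -mulr_natl.
  transitivity (circle_height u ^+ k.+2 - k.+2%:R * circle_height u ^+ k * u ^+ 2).
    by rewrite u2 [in k.+3%:R]mulrS !exprS; ring.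
  by rewrite [in RHS]exprS; field; rewrite gt_eqF.
have [c c01 Ec] := integral_sub_primitive cf cF dFE.
move: Ec; rewrite /F circle_height1 !expr0n mulr0 mul0r !subr0 subrr.
rewrite /f RintegralB//; first rewrite !RintegralZl//.
all: try exact/continuous_integrable/continuous_circle_heightX.
all: try exact/continuous_integrable/cZ.
by move=> /eqP; rewrite subr_eq0 /wallis -!lock => /eqP E; rewrite mulrCA E mulrCA.
Qed.

(** * Negative roots of the Steiner polynomials of cubes *)

(** The volume of the unit ball of dimension n. *)
Definition kappa n := \prod_(k < n) wallis k.

Lemma kappaS n : kappa n.+1 = kappa n * wallis n.
Proof. by rewrite /kappa big_ord_recr. Qed.

Lemma kappa_gt0 n : 0 < kappa n.
Proof. by apply: prodr_gt0 => i _. Qed.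

Lemma wallis01_gt0 : 0 < 2 * wallis 0 * wallis 1.
Proof. by rewrite mulr_gt0// mulr_gt0. Qed.

(** The product (j + 2) w_j w_(j+1) does not depend on j, by [wallis_rec]. *)
Lemma kappa_rec j : kappa j = j.+2%:R / (2 * wallis 0 * wallis 1) * kappa j.+2.
Proof.
have wc : j.+2%:R * wallis j * wallis j.+1 = 2 * wallis 0 * wallis 1.
  elim: j => [//|j IH]; rewrite -IH mulrAC wallis_rec; ring.
rewrite !kappaS -wc; field.
by rewrite !gt_eqF.
Qed.

(** Up to the factor kappa (j + 2m), kappa is a polynomial in j with negative
    integer zeros: Euler's product for the Gamma function in disguise. *)
Lemma kappa_shift j m : kappa j =
  (\prod_(i < m) (j + i.+1.*2)%:R) / (2 * wallis 0 * wallis 1) ^+ m * kappa (j + m.*2).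
Proof.
elim: m => [|m IH]; first by rewrite big_ord0 expr0 addn0 divr1 mul1r.
rewrite big_ord_recr /= exprS [LHS]IH [in LHS]kappa_rec.
have -> : (j + m.*2).+2 = (j + m.+1.*2)%N by rewrite doubleS !addnS.
by set c := 2 * _ * _; rewrite (invfM c); ring.
Qed.

(** What m Laguerre operators make of (2 + l X)^n. *)
Definition laguerre_iter n a (l : R) m : {poly R} :=
  \poly_(k < n.+1)
    ('C(n, k)%:R * 2 ^+ (n - k) * l ^+ k * \prod_(i < m) (k + a + i.+1.*2)%:R).

Lemma laguerre_iter_neq0 n a l m : laguerre_iter n a l m != 0.
Proof.
apply/eqP => /(congr1 (fun p : {poly R} => p`_0)); rewrite coef_poly /= coef0.
apply/eqP; rewrite bin0 expr0 mul1r mulr1 mulf_neq0 ?expf_neq0 ?pnatr_eq0//.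
by apply/prodf_neq0 => i _; rewrite pnatr_eq0 doubleS !addnS.
Qed.

Lemma laguerre_iter_all_roots_negative n a l m : 0 < l ->
  all_roots_negative (laguerre_iter n a l m).
Proof.
move=> l0; elim: m => [|m IH].
  have -> : laguerre_iter n a l 0 =
      (l ^+ n) *: \prod_(r <- nseq n (- (2 / l))) ('X - r%:P).
    have -> : \prod_(r <- nseq n (- (2 / l))) ('X - r%:P) =
        ('X + (2 / l)%:P) ^+ n.
      by rewrite big_nseq iter_mulr_1 polyCN opprK.
    rewrite -exprZn scalerDr -[l *: _%:P]mul_polyC -polyCM mulrCA divff ?gt_eqF//.
    rewrite mulr1 addrC exprDn /laguerre_iter poly_def; apply: eq_bigr => k _.
    rewrite big_ord0 mulr1 -polyC_exp mul_polyC exprZn scalerA scalerMnl.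
    by rewrite -mulrA mulr_natl.
  move=> z /complex_root_prod[|r]; first by rewrite expf_neq0 ?gt_eqF.
  by rewrite mem_nseq => /andP[_ /eqP->] -> /=; rewrite oppr_lt0 divr_gt0.
have -> : laguerre_iter n a l m.+1 = 'X * (laguerre_iter n a l m)^`() +
    (a + m.+1.*2)%:R *: laguerre_iter n a l m.
  apply/polyP => k; rewrite coefD coefXM coefZ coef_deriv !coef_poly.
  rewrite big_ord_recr /=.
  case: k => [|k] /=; first by rewrite !add0r !natrD; ring.
  rewrite !ltnS; case: ifP => _; last by rewrite mul0rn mulr0 addr0.
  by rewrite -mulr_natr !natrD; ring.
apply: all_roots_negative_Laguerre => //.
exact: laguerre_iter_neq0.
Qed.

Lemma wallis_ratio_cvg j : (fun M => wallis M / wallis (M + j)%N) @ \oo --> (1 : R).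
Proof.
elim: j => [|j IH].
  under eq_fun do rewrite addn0 divff ?gt_eqF//.
  exact: cvg_cst.
have h1 : (fun M => wallis M / wallis M.+1) @ \oo --> (1 : R).
  apply: (@squeeze_cvgr _ _ _ _ (cst 1) (fun M => 1 + M.+2%:R^-1)).
  - near=> M => /=; rewrite ler_pdivlMr// mul1r wallis_noninc /=.
    rewrite ler_pdivrMr//.
    have -> : 1 + M.+2%:R^-1 = M.+3%:R / M.+2%:R :> R.
      by rewrite -[M.+3]addn1 natrD mulrDl divff ?pnatr_eq0// mul1r.
    rewrite mulrAC ler_pdivlMr ?ltr0n// [wallis M * _]mulrC -wallis_rec.
    by rewrite ler_wpM2l ?wallis_noninc.
  - exact: cvg_cst.
  - have h : (fun M => M.+2%:R^-1) @ \oo --> (0 : R).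
      by have := @cvg_harmonic R; rewrite -cvg_shiftS.
    have := cvgD (cvg_cst (1 : R)) h.
    by rewrite addr0; apply.
have h2 : (fun M => wallis (M + j)%N / wallis (M + j).+1) @ \oo --> (1 : R).
  by have := h1; rewrite -(cvg_shiftn j).
rewrite [X in X @ _](_ : _ =
    (fun M => wallis M / wallis (M + j)%N) \*
    (fun M => wallis (M + j)%N / wallis (M + j).+1)).
  by rewrite -[X in _ --> X]mulr1; exact: cvgM.
by apply/funext => M /=; rewrite addnS mulrA divfK ?gt_eqF.
Unshelve. all: by end_near. Qed.

(** The error made when kappa (M + k) is replaced by the geometric progression
    kappa M * wallis M ^+ k, as a multiplicative factor. *)
Definition steiner_ratio M k := \prod_(j < k) (wallis M / wallis (M + j)%N).

Lemma steiner_ratioE M k :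
  steiner_ratio M k = kappa M * wallis M ^+ k / kappa (M + k).
Proof.
elim: k => [|k IH].
  by rewrite /steiner_ratio big_ord0 addn0 expr0 mulr1 divff ?gt_eqF ?kappa_gt0.
rewrite /steiner_ratio big_ord_recr /= -/(steiner_ratio M k) IH addnS kappaS exprSr.
by rewrite (invfM (kappa _)); ring.
Qed.

Lemma wallis_noninc_add M j : wallis (M + j) <= wallis M.
Proof.
by elim: j => [|j IH]; rewrite ?addn0// addnS (le_trans (wallis_noninc _)).
Qed.

Lemma steiner_ratio_ge1 M k : 1 <= steiner_ratio M k.
Proof.
rewrite /steiner_ratio; elim: k => [|k IH]; rewrite ?big_ord0// big_ord_recr /=.
by rewrite mulr_ege1// ler_pdivlMr// mul1r wallis_noninc_add.
Qed.

Lemma steiner_ratio_cvg k : (fun M => steiner_ratio M k) @ \oo --> (1 : R).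
Proof.
elim: k => [|k IH].
  rewrite [X in X @ _](_ : _ = cst 1); first exact: cvg_cst.
  by apply/funext => M; rewrite /steiner_ratio big_ord0.
rewrite [X in X @ _](_ : _ =
    (fun M => steiner_ratio M k) \* (fun M => wallis M / wallis (M + k)%N)).
  by rewrite -[X in _ --> X]mulr1; apply: cvgM => //; exact: wallis_ratio_cvg.
by apply/funext => M /=; rewrite /steiner_ratio big_ord_recr.
Qed.

(** The Steiner polynomial of the cube of side 2 in dimension n, embedded in
    dimension n + a, divided by X^a. *)
Definition steiner_poly n a : {poly R} :=
  \poly_(k < n.+1) ('C(n, k)%:R * 2 ^+ (n - k) * kappa (k + a)).

(** The polynomial [steiner_poly n a] with its coefficients perturbed so that
    it becomes a multiple of some [laguerre_iter]. *)
Definition steiner_approx n a m : {poly R} := \poly_(k < n.+1)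
  ('C(n, k)%:R * 2 ^+ (n - k) * kappa (k + a) * steiner_ratio (a + m.*2) k).

Lemma steiner_approxE n a m : steiner_approx n a m =
  (kappa (a + m.*2) / (2 * wallis 0 * wallis 1) ^+ m) *:
    laguerre_iter n a (wallis (a + m.*2)) m.
Proof.
apply/polyP => k; rewrite coefZ !coef_poly; case: ifP => _; last by rewrite mulr0.
rewrite steiner_ratioE (kappa_shift (k + a) m).
have -> : (k + a + m.*2)%N = (a + m.*2 + k)%N by rewrite -addnA addnC.
have := kappa_gt0 (a + m.*2 + k) => /gt_eqF k0.
set P := \prod_(_ < _) _; field.
by rewrite k0 andbT expf_neq0// gt_eqF// wallis01_gt0.
Qed.

(** The approximants have only negative roots and converge coefficientwise with
    a leading coefficient bounded below, so the lower bound on their values at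
    a non-real point survives in the limit. *)
Lemma steiner_poly_real_rooted n a z : complex_root (steiner_poly n a) z ->
  Im z = 0.
Proof.
move=> rz; apply/eqP/negPn/negP => Iz.
pose c k := 'C(n, k)%:R * 2 ^+ (n - k) * kappa (k + a).
(* A bound for the perturbation at z. *)
pose S m := \sum_(k < n.+1) c k * normc z ^+ k * (steiner_ratio m k - 1).
have c_gt0 k : (k <= n)%N -> 0 < c k.
  by move=> kn; rewrite !mulr_gt0 ?kappa_gt0 ?exprn_gt0 ?ltr0n ?bin_gt0.
have Scvg : S @ \oo --> (0 : R).
  rewrite (_ : 0 = \sum_(k < n.+1) c k * normc z ^+ k * (1 - 1)); last first.
    by rewrite big1// => k _; rewrite subrr mulr0.
  rewrite /S; apply: cvg_big => [|k _]; first exact: add_continuous.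
  apply: cvgM; first exact: cvg_cst.
  by apply: cvgB; [exact: steiner_ratio_cvg|exact: cvg_cst].
pose d := c n * `|Im z| ^+ n.
have d_gt0 : 0 < d by rewrite mulr_gt0 ?c_gt0// exprn_gt0 ?normr_gt0.
have [N _ HN] : \forall m \near \oo, S m < d by exact: cvgr_lt Scvg _ d_gt0.
(* Only the indices of the form a + 2 m give approximants with negative roots. *)
have /HN /= : (N <= a + N.*2)%N by rewrite -addnn addnA leq_addl.
rewrite ltNge => /negP; apply.
set p := steiner_approx n a N.
have sp : size p = n.+1.
  apply: size_poly_eq; rewrite !mulf_neq0 ?gt_eqF ?kappa_gt0 ?ltr0n ?bin_gt0//.
  exact: lt_le_trans (steiner_ratio_ge1 _ _).
have p0 : p != 0 by rewrite -size_poly_eq0 sp.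
have hp : all_roots_negative p.
  rewrite /p steiner_approxE => x; rewrite /complex_root map_polyZ rootZ.
    by apply: laguerre_iter_all_roots_negative.
  by rewrite fmorph_eq0 gt_eqF// divr_gt0 ?kappa_gt0// exprn_gt0// wallis01_gt0.
have lp : d <= `|lead_coef p| * `|Im z| ^+ (size p).-1.
  rewrite sp /= ler_wpM2r ?exprn_ge0// lead_coefE sp /= coef_poly leqnn.
  rewrite -/(c n) normrM (gtr0_norm (c_gt0 _ _))// ler_pMr ?c_gt0//.
  exact: le_trans (steiner_ratio_ge1 _ _) (ler_norm _).
apply: le_trans lp _; apply: le_trans (normc_ge_Im_pow z hp p0) _.
have -> : (map_poly toC p).[z] = (map_poly toC (p - steiner_poly n a)).[z].
  rewrite rmorphB hornerD hornerN; move: rz.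
  by rewrite /complex_root rootE => /eqP->; rewrite subr0.
have -> : p - steiner_poly n a =
    \poly_(k < n.+1) (c k * (steiner_ratio (a + N.*2) k - 1)).
  apply/polyP => k; rewrite coefB !coef_poly; case: ifP => _; last by rewrite subrr.
  by rewrite -/(c k) mulrBr mulr1.
apply: le_trans (normc_horner_le _ _ _) _; apply: ler_sum => k _.
have h : 0 <= c k * (steiner_ratio (a + N.*2) k - 1).
  apply: mulr_ge0; first by rewrite ltW// c_gt0// -ltnS.
  by rewrite subr_ge0 steiner_ratio_ge1.
by rewrite (ger0_norm h) mulrAC lexx.
Qed.

Lemma steiner_poly_all_roots_negative n a : all_roots_negative (steiner_poly n a).
Proof.
move=> z rz; have Iz := steiner_poly_real_rooted rz; split => //.
rewrite ltNge; apply/negP => Rz.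
have Ez : z = (Re z)%:C%C by rewrite {1}(complex_eta z) Iz.
move: rz; rewrite Ez complex_rootE rootE; apply/negP/lt0r_neq0.
rewrite /steiner_poly horner_poly big_ord_recl /= expr0 mulr1.
apply: ltr_wpDr; last by rewrite !mulr_gt0 ?exprn_gt0 ?kappa_gt0 ?ltr0n ?bin_gt0.
by apply: sumr_ge0 => k _; rewrite !mulr_ge0 ?exprn_ge0// ltW ?kappa_gt0.
Qed.

(** * Roots of the polynomial of the squeezed ball *)

(** The Minkowski polynomial of the squeezed ball, up to the factor X and a
    constant: the integral of (1 + X x)^n with x = circle_height u over -1 <= u
    <= 1. *)
Definition ball_poly n : {poly R} :=
  \poly_(k < n.+1) ('C(n, k)%:R * wallis k).

(** In the closed right half plane the modulus increases along the ray from 1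
    through 1 + z. *)
Lemma normc_add1_lt z (x : R) : z != 0 -> 0 <= Re z -> 0 <= x < 1 ->
  normc (1 + z * x%:C%C) < normc (1 + z).
Proof.
case: z => a b; rewrite eq_complex /= => ab a0 /andP[x0 x1].
rewrite !mulr0 subr0 !add0r.
have ab2 : 0 < a ^+ 2 + b ^+ 2.
  by rewrite lt0r addr_ge0 ?sqr_ge0// paddr_eq0 ?sqr_ge0// !sqrf_eq0 ab.
have h1 : a * x <= a by rewrite ler_piMr// ltW.
have h2 : x ^+ 2 * (a ^+ 2 + b ^+ 2) < a ^+ 2 + b ^+ 2.
  by rewrite gtr_pMl// expr_lt1.
rewrite ltr_sqrt; last by rewrite ltr_wpDr ?sqr_ge0// exprn_gt0// ltr_wpDr.
rewrite -subr_gt0.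
have -> : (1 + a) ^+ 2 + b ^+ 2 - ((1 + a * x) ^+ 2 + (b * x) ^+ 2) =
  2 * (a - a * x) + (a ^+ 2 + b ^+ 2 - x ^+ 2 * (a ^+ 2 + b ^+ 2)) by ring.
by rewrite ltr_wpDl ?mulr_ge0 ?subr_ge0 ?subr_gt0.
Qed.

(** At a root z with Re z >= 0, take q(x) = Re (conj (1 + z)^N (1 + z x)^N)
    with N = n + 1. Its maximum on [0, 1] is attained at 1 only, so moment q' >
    0; but moment q' = N Re (conj (1 + z)^N z D(z)) = 0, with D = [ball_poly
    n]. *)
Lemma dissipative_ball_poly n : dissipative (ball_poly n).
Proof.
move=> z rz; rewrite ltNge; apply/negP => Rz.
have z0 : z != 0.
  apply: contraTneq rz => ->.
  rewrite (_ : 0 = 0%:C%C)// complex_rootE rootE horner_coef0 coef_poly /=.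
  by rewrite bin0 mul1r gt_eqF.
pose c := conjc (1 + z) ^+ n.+1.
pose q := \poly_(k < n.+2) ('C(n.+1, k)%:R * Re (c * z ^+ k)).
have qE x : q.[x] = Re (c * (1 + z * x%:C%C) ^+ n.+1).
  rewrite horner_poly exprDn mulr_sumr Re_sum; apply: eq_bigr => k _.
  rewrite expr1n mul1r exprMn mulrnAr -[in RHS]mulr_natr.
  rewrite -[_%:R in RHS](rmorph_nat toC) Re_mul_real.
  by rewrite mulrA -rmorphXn Re_mul_real; ring.
have : 0 < moment q^`().
  apply: moment_deriv_gt0 => x x01; rewrite !qE mulr1.
  apply: le_lt_trans (Re_le_normc _) _.
  have -> : Re (c * (1 + z) ^+ n.+1) = normc (1 + z) ^+ n.+1 * normc (1 + z) ^+ n.+1.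
    rewrite -!exprMn mulrC.
    have -> : (1 + z) * conjc (1 + z) = (normc (1 + z) * normc (1 + z))%:C%C.
      case: (1 + z) => a b /=; rewrite -expr2 sqr_sqrtr ?addr_ge0 ?sqr_ge0//.
      by apply/eqP; rewrite eq_complex /=; apply/andP; split; apply/eqP; ring.
    by rewrite -rmorphXn.
  rewrite normcM !normc_exp normc_conj ltr_pM2l.
    by rewrite ltrXn2r// ?normc_ge0// normc_add1_lt.
  rewrite exprn_gt0//; apply: le_lt_trans (normc_ge0 _) (normc_add1_lt z0 Rz x01).
rewrite (@momentE n.+1); last first.
  by apply: size_deriv_le; exact: size_poly.
have -> : \sum_(k < n.+1) q^`()`_k * wallis k = \sum_(k < n.+1)
    n.+1%:R * Re (c * z * (('C(n, k)%:R * wallis k)%:C%C * z ^+ k)).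
  apply: eq_bigr => k _.
  rewrite coef_deriv coef_poly !ltnS leq_ord -mulr_natr [_%:C%C * _]mulrC mulrA.
  have bin : k.+1%:R * 'C(n.+1, k.+1)%:R = n.+1%:R * 'C(n, k)%:R :> R.
    by rewrite -!natrM -mul_bin_diag.
  rewrite Re_mul_real -(mulrA c) -exprS mulrCA (mulrA n.+1%:R) -bin.
  by set u := Re _; ring.
rewrite -mulr_sumr -Re_sum -mulr_sumr.
have -> : \sum_(k < n.+1) (('C(n, k)%:R * wallis k)%:C%C * z ^+ k) =
    (map_poly toC (ball_poly n)).[z].
  have -> : map_poly toC (ball_poly n) = \poly_(k < n.+1) ('C(n, k)%:R * wallis k)%:C%C.
    apply/polyP => k; rewrite coef_map !coef_poly.
    by case: ifP => // _; rewrite rmorph0.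
  by rewrite horner_poly.
by move: rz => /eqP ->; rewrite mulr0 /= mulr0 ltxx.
Qed.

(** Strictness in Cauchy-Schwarz: the integral of (x - c)^2 is positive for c =
    w_1 / w_0. It is obtained from the increasing function (x - c)^3. *)
Lemma wallis_log_convex : wallis 1 ^+ 2 < wallis 0 * wallis 2.
Proof.
pose c := wallis 1 / wallis 0.
have h : 0 < moment (('X - c%:P) ^+ 3)^`().
  apply: moment_deriv_gt0 => x /andP[x0 x1]; rewrite !horner_exp !hornerXsubC.
  set a := x - c; have : a < 1 - c by rewrite ltrD2r.
  move: (1 - c) => b ab; rewrite -subr_gt0.
  have -> : b ^+ 3 - a ^+ 3 = (b - a) * ((b + a / 2) ^+ 2 + 3 / 4 * a ^+ 2).
    by field.
  rewrite mulr_gt0 ?subr_gt0//.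
  have [a0|a0] := eqVneq a 0.
    by rewrite a0 mul0r addr0 expr0n /= mulr0 addr0 exprn_gt0// -a0.
  rewrite ltr_wpDl ?sqr_ge0// mulr_gt0// ?exprn_even_gt0//=; lra.
move: h; rewrite (@momentE 3); last first.
  by apply: size_deriv_le; rewrite size_exp_XsubC.
rewrite !big_ord_recr big_ord0 /= deriv_exp derivXsubC mul1r /= expr2.
rewrite !coefMn !mulrBl !coefB !coefXM !coefCM !coefB !coefX !coefC /= => h.
have w0 := wallis_gt0 0; have Ew : wallis 1 = c * wallis 0 by rewrite divfK// gt_eqF.
by move: h; rewrite Ew; nra.
Qed.

(** Real-rootedness gives n w_1^2 >= (n - 1) w_0 w_2 through
    [real_rooted_coef012], which fails for large n by [wallis_log_convex]. *)
Lemma ball_poly_nonreal_root :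
  exists n0, forall n, (n0 <= n)%N -> has_nonreal_root (ball_poly n).
Proof.
(* Beyond the bound, n d > w_0 w_2, where d is the gap in log-convexity. *)
have d0 : 0 < wallis 0 * wallis 2 - wallis 1 ^+ 2 by rewrite subr_gt0 wallis_log_convex.
set d := _ - _ in d0.
exists (Num.bound (wallis 0 * wallis 2 / d)).+2 => n n0n; apply: contrapT => hn.
have hr z : complex_root (ball_poly n) z -> Im z = 0.
  by move=> rz; apply: contrapT => Iz; apply: hn; exists z.
have := real_rooted_coef012 hr; rewrite !coef_poly !ltnS.
have -> : (1 <= n)%N by apply: leq_trans n0n.
have -> : (2 <= n)%N by apply: leq_trans n0n.
rewrite leq0n bin0 bin1 mul1r.
have -> : 'C(n, 2)%:R = n%:R * (n%:R - 1) / 2 :> R.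
  have /(congr1 (fun k => k%:R : R)) : ('C(n, 2) * 2 = n * n.-1)%N.
    rewrite bin2 muln2 -[RHS]odd_double_half.
    by case: n {n0n hn hr} => // n; rewrite /= oddM /= andNb.
  rewrite !natrM -subn1 natrB ?(leq_trans _ n0n)// => <-; by field.
have nb : wallis 0 * wallis 2 / d < n%:R.
  have x0 : 0 <= wallis 0 * wallis 2 / d by rewrite divr_ge0 ?mulr_ge0 ?ltW.
  apply: (lt_le_trans (archi_boundP x0)); rewrite ler_nat.
  exact: ltnW (ltnW n0n).
have n1 : 1 <= n%:R :> R by rewrite ler1n (leq_trans _ n0n).
rewrite leNgt => /negP; apply.
have -> : 2 * wallis 0 * (n%:R * (n%:R - 1) / 2 * wallis 2) =
  (n%:R * wallis 1) ^+ 2 + n%:R * (n%:R * d - wallis 0 * wallis 2) by rewrite /d; field.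
rewrite ltrDl; apply: mulr_gt0; first exact: lt_le_trans n1.
by rewrite subr_gt0 -ltr_pdivrMr.
Qed.

(** * Integrals over slices *)

(** The volume of the neighbourhood of radius r, one dimension higher, when p
    gives the volume of the neighbourhoods in the slices: a slice at height s
    meets it in a neighbourhood of radius sqrt (r^2 - s^2). *)
Definition slice_poly p : {poly R} := 'X * \poly_(k < size p) (p`_k * wallis k).

Lemma horner_slice_poly p r : (slice_poly p).[r] =
  moment (\poly_(k < size p) (p`_k * r ^+ k.+1)).
Proof.
rewrite /slice_poly hornerM hornerX horner_poly.
rewrite (@momentE (size p)) ?size_poly// mulr_sumr.
by apply: eq_bigr => k _; rewrite coef_poly ltn_ord exprS; ring.
Qed.

Lemma continuous_sqrt_sub_sqr (r : R) (m : R -> R) : continuous m ->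
  continuous (fun x => Num.sqrt (r ^+ 2 - m x ^+ 2)).
Proof.
move=> cm x; apply: (@continuous_comp R R R (fun x => r ^+ 2 - m x ^+ 2) Num.sqrt).
  apply: continuousB; first exact: cvg_cst.
  apply: (@continuous_comp R R R m (fun x => x ^+ 2)); first exact: cm.
  exact: exprn_continuous.
exact: sqrt_continuous.
Qed.

(** The substitution x = c + r u turns sqrt (r^2 - (x - c)^2) into r *
    circle_height u. *)
Lemma integral_half_slice p (c r : R) : 0 <= r ->
  2 * \int[mu]_(x in `[c, c + r]) p.[Num.sqrt (r ^+ 2 - (x - c) ^+ 2)] =
  (slice_poly p).[r].
Proof.
rewrite le_eqVlt => /predU1P[<-|r0].
  by rewrite addr0 set_itv1 Rintegral_set1 mulr0 /slice_poly hornerM hornerX mul0r.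
rewrite horner_slice_poly moment_wallis; congr (2 * _).
pose G x := p.[Num.sqrt (r ^+ 2 - (x - c) ^+ 2)].
pose F u := c + r * u.
have dF (u : R) : is_derive u 1 F r.
  by apply: is_derive_eq; rewrite /GRing.scale /=; ring.
have F' : derive1 F = cst r.
  by apply/funext => u; rewrite derive1E; apply: derive_val.
have F0 : F 0 = c by rewrite /F mulr0 addr0.
have F1 : F 1 = c + r by rewrite /F mulr1.
have cG : continuous G.
  move=> x; apply: (@continuous_comp R R R
      (fun x => Num.sqrt (r ^+ 2 - (x - c) ^+ 2)) (horner p)).
    apply: (@continuous_sqrt_sub_sqr r (fun x => x - c)) => {}x.
    by apply: cvgB; [exact: cvg_id|exact: cvg_cst].
  exact: continuous_horner.
have cF : continuous F.
  move=> u; apply: cvgD; first exact: cvg_cst.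
  by apply: cvgM; [exact: cvg_cst|exact: cvg_id].
have GF (u : R) : G (F u) * r = (\poly_(k < size p) (p`_k * r ^+ k.+1)).[circle_height u].
  rewrite /G /F horner_poly horner_coef mulr_suml.
  have -> : Num.sqrt (r ^+ 2 - (c + r * u - c) ^+ 2) = r * circle_height u.
    rewrite [c + _]addrC addrK exprMn -[X in X - _]mulr1 -mulrBr.
    by rewrite sqrtrM ?sqr_ge0// sqrtr_sqr gtr0_norm.
  by apply: eq_bigr => k _; rewrite exprMn exprS; ring.
rewrite /Rintegral; congr fine.
have := @integration_by_substitution_increasing R F G 0 1.
rewrite F0 F1 F' => -> //.
- by apply: eq_integral => u _; rewrite fctE /= GF.
- by move=> x y _ _ xy; rewrite ltrD2l ltr_pM2l.
- by move=> x _; exact: cvg_cst.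
- exact: is_cvg_cst.
- exact: is_cvg_cst.
- split.
  + by move=> x _; case: (dF x).
  + exact/cvg_at_right_filter/cF.
  + exact/cvg_at_left_filter/cF.
- exact: continuous_subspaceT.
Qed.

(** The distance from x to the interval [-c, c], for c >= 0. *)
Definition excess (c x : R) := Num.max (`|x| - c) 0.

Lemma continuous_excess c : continuous (excess c).
Proof.
move=> x; apply: (@continuous_max _ _ (fun x => `|x| - c) (cst 0)).
  by apply: cvgB; [exact: norm_continuous|exact: cvg_cst].
exact: cvg_cst.
Qed.

Lemma excess_ge0 c x : 0 <= excess c x.
Proof. by rewrite le_max lexx orbT. Qed.

Definition slice_fun p (c r x : R) : \bar R :=
  if `|x| <= c + r then p.[Num.sqrt (r ^+ 2 - excess c x ^+ 2)]%:E else 0%E.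

(** The integral splits into the part |x| <= c, where the slice has the full
    radius r, and two caps that together contribute [slice_poly p]. *)
Lemma integral_slice p (c r : R) : 0 <= c -> 0 <= r ->
  (\int[mu]_x slice_fun p c r x)%E = ((2 * c) *: p + slice_poly p).[r]%:E.
Proof.
move=> c0 r0; pose h x := p.[Num.sqrt (r ^+ 2 - excess c x ^+ 2)].
have ch : continuous h.
  move=> x; apply: (@continuous_comp R R R
      (fun x => Num.sqrt (r ^+ 2 - excess c x ^+ 2)) (horner p)).
    exact: continuous_sqrt_sub_sqr (@continuous_excess c) _.
  exact: continuous_horner.
have ih a b : mu.-integrable `[a, b] (EFin \o h) by exact: continuous_integrable.
have cr0 : 0 <= c + r by rewrite addr_ge0.
transitivity (\int[mu]_(x in `[(- (c + r))%R, (c + r)%R]) (h x)%:E)%E.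
  rewrite [RHS]integral_mkcond; apply: eq_integral => x _.
  by rewrite /slice_fun patchE mem_setE in_itv /= ler_norml.
transitivity (\int[mu]_(x in `[- (c + r), c + r]) h x)%:E.
  by rewrite /Rintegral fineK// integrable_fin_num.
congr EFin.
have split (a b x : R) : a <= x -> x <= b -> \int[mu]_(x in `[a, b]) h x =
    \int[mu]_(x in `[a, x]) h x + \int[mu]_(x in `[x, b]) h x.
  move=> ax xb; rewrite -(@Rintegral_itv_obnd_cbnd _ x).
    by rewrite -(@Rintegral_itvB _ h (BLeft a)) ?bnd_simp// addrC subrK.
  by apply: integrableS (ih x b) => //; exact: subset_itv_oc_cc.
rewrite (split _ _ 0) ?oppr_le0//.
have -> : \int[mu]_(x in `[- (c + r), 0]) h x = \int[mu]_(x in `[0, c + r]) h x.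
  rewrite -[X in `[_, X]]oppr0 /Rintegral integration_by_substitution_oppr//.
    by congr fine; apply: eq_integral => x _; rewrite /= /h /excess normrN.
  exact: continuous_subspaceT.
rewrite (split 0 _ c) ?lerDl//.
have -> : \int[mu]_(x in `[0, c]) h x = c * p.[r].
  rewrite (@eq_Rintegral _ _ _ _ _ (cst p.[r])) => [|x].
    rewrite Rintegral_cst// mulrC; congr (_ * _).
    have := @lebesgue_measure_itv R `[0, c].
    rewrite /= lte_fin => E; rewrite [X in fine X](_ : _ = c%:E)// [LHS]E.
    move: c0; case: ltgtP => // [_ _|<- //].
    by rewrite oppr0 adde0.
  rewrite inE /= in_itv /= => /andP[x0 xc]; rewrite /h /excess ger0_norm//.
  by rewrite max_r ?subr_le0// expr0n subr0 sqrtr_sqr ger0_norm.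
have -> : \int[mu]_(x in `[c, c + r]) h x =
    \int[mu]_(x in `[c, c + r]) p.[Num.sqrt (r ^+ 2 - (x - c) ^+ 2)].
  apply: eq_Rintegral => x; rewrite inE /= in_itv /= => /andP[cx _].
  by rewrite /h /excess ger0_norm ?(le_trans c0)// max_l ?subr_ge0.
by rewrite hornerD hornerZ -(integral_half_slice p c r0); ring.
Qed.

(** * Slices of Lebesgue measure and the volume of a box neighbourhood *)

Lemma lebesgue_tuple_slice n (A : set (n.+1.-tuple T)) :
  leb n.+1 A = (\int[mu]_x leb n [set t | A (tuple_cons (x, t))])%E.
Proof.
rewrite /= /lebesgue_cons /pushforward /product_measure1.
apply: eq_integral => x _; congr (leb n _).
by apply/seteqP; split => t; rewrite /xsection /= inE.
Qed.

Definition box_nbhd (c : nat -> R) n (r : R) : set (n.-tuple T) :=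
  [set t | \sum_(i < n) excess (c i) (tnth t i) ^+ 2 <= r ^+ 2].

Arguments box_nbhd : clear implicits.

(** Steiner's formula for the box with half-sides c 0, ..., c (n - 1), computed
    by slicing along the first coordinate. *)
Fixpoint box_poly (c : nat -> R) n : {poly R} :=
  if n is m.+1 then
    (2 * c 0) *: box_poly (c \o succn) m + slice_poly (box_poly (c \o succn) m)
  else 1.

Lemma lebesgue_box_nbhd c n (r : R) : (forall i, 0 <= c i) -> 0 <= r ->
  leb n (box_nbhd c n r) = (box_poly c n).[r]%:E.
Proof.
move=> c_ge0; elim: n c c_ge0 r => [|n IH] c c_ge0 r r0.
  rewrite /= diracE hornerC mem_set// /box_nbhd /= big_ord0 sqr_ge0//.
rewrite lebesgue_tuple_slice -integral_slice//; apply: eq_integral => x _.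
have slice (t : n.-tuple T) : box_nbhd c n.+1 r (tuple_cons (x, t)) =
    (\sum_(i < n) excess (c i.+1) (tnth t i) ^+ 2 <= r ^+ 2 - excess (c 0) x ^+ 2).
  rewrite /box_nbhd /= big_ord_recl /= tnth0 lerBrDl.
  by under [X in is_true (_ + X <= _)]eq_bigr do rewrite tnthS.
under eq_set do rewrite slice.
rewrite /slice_fun.
have xrE : (`|x : R| <= c 0 + r) = (excess (c 0) x ^+ 2 <= r ^+ 2).
  rewrite ler_sqr ?nnegrE ?excess_ge0// /excess ge_max r0 andbT.
  by rewrite lerBlDl.
case: ifPn; rewrite xrE => xr.
  rewrite -(IH (c \o succn) (fun i => c_ge0 i.+1) _ (sqrtr_ge0 _)).
  congr (leb n _).
  by rewrite /box_nbhd sqr_sqrtr ?subr_ge0.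
rewrite [X in leb n X](_ : _ = set0) ?measure0//; apply/seteqP; split => t //= h.
move: xr; rewrite -subr_ge0 => /negP; apply; apply: le_trans h.
by apply: sumr_ge0 => i _; rewrite sqr_ge0.
Qed.

Definition tuple_rcons n (t : n.-tuple T) (s : T) : n.+1.-tuple T :=
  [tuple of rcons t s].

Lemma measurable_rcons d (T1 : measurableType d) (f : T1 -> T) n
    (g : T1 -> n.-tuple T) :
  measurable_fun setT f -> measurable_fun setT g ->
  measurable_fun setT (fun x => tuple_rcons (g x) (f x)).
Proof.
move=> mf mg; apply/measurable_fun_tnthP => i.
have [ilt|ige] := ltnP i n.
  rewrite (_ : _ \o _ = fun x => tnth (g x) (Ordinal ilt)).
    by move/measurable_fun_tnthP : mg; apply.
  by apply/funext => x /=; rewrite !(tnth_nth point) /= nth_rcons size_tuple ilt.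
rewrite (_ : _ \o _ = f)//; apply/funext => x /=.
rewrite (tnth_nth point) /= nth_rcons size_tuple ltnNge ige /=.
by rewrite eqn_leq ige -ltnS ltn_ord.
Qed.

(** The measure is defined by adding coordinates in front; Tonelli's theorem
    moves the slicing to the last coordinate, where the squeezed direction
    lies. *)
Lemma lebesgue_tuple_slice_last n (A : set (n.+1.-tuple T)) : measurable A ->
  leb n.+1 A = (\int[mu]_s leb n [set t | A (tuple_rcons t s)])%E.
Proof.
elim: n A => [|n IH] A mA.
  rewrite lebesgue_tuple_slice; apply: eq_integral => s _; congr (leb 0 _).
  apply/seteqP; split => t /=; rewrite (tuple0 t);
    by rewrite (_ : tuple_cons _ = tuple_rcons [tuple] s)//; exact: val_inj.
pose g (p : (T * T) * n.-tuple T) : n.+2.-tuple T :=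
  tuple_cons (p.1.1, tuple_rcons p.2 p.1.2).
have mg : measurable_fun setT g.
  have m1 : measurable_fun setT (fun p : (T * T) * n.-tuple T => p.1.1).
    exact: measurableT_comp measurable_fst measurable_fst.
  have m2 : measurable_fun setT (fun p : (T * T) * n.-tuple T => p.1.2).
    exact: measurableT_comp measurable_snd measurable_fst.
  apply: measurable_cons => //.
  exact: measurable_rcons m2 measurable_snd.
have mB : measurable (g @^-1` A) by rewrite -[X in measurable X]setTI; exact: mg.
pose f (p : T * T) := leb n (xsection (g @^-1` A) p).
have mf := measurable_fun_xsection (leb n) mB.
rewrite -/f in mf.
rewrite lebesgue_tuple_slice.
transitivity (\int[mu]_a \int[mu]_s f (a, s))%E.
  apply: eq_integral => a _; rewrite IH; last first.
    have mcons : measurable_fun setT (fun t : n.+1.-tuple T => tuple_cons (a, t)).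
      by apply: measurable_cons; [exact: measurable_cst|exact: measurable_id].
    by rewrite -[X in measurable X]setTI; exact: mcons.
  apply: eq_integral => s _; congr (leb n _); rewrite xsectionE.
  by apply/seteqP; split => t /=;
    rewrite (_ : tuple_cons _ = g ((a, s), t))//; exact: val_inj.
have f0 xy : (0 <= f xy)%E by exact: measure_ge0.
rewrite (fubini_tonelli (m1 := mu) (m2 := mu) f mf f0).
apply: eq_integral => s _; rewrite lebesgue_tuple_slice.
apply: eq_integral => a _; congr (leb n _); rewrite xsectionE.
by apply/seteqP; split => t /=;
  rewrite (_ : g ((a, s), t) = tuple_rcons (tuple_cons (a, t)) s)//;
  exact: val_inj.
Qed.

(** * Parallel bodies of boxes and balls *)

(** A vanishing half-side is allowed, so that squeezed cubes are boxes too. *)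
Definition centered_box (c : nat -> R) n : set 'rV[R]_n :=
  [set x | forall i : 'I_n, `|x 0 i| <= c i].

Arguments centered_box : clear implicits.

Lemma sqr_norm (x : R) : `|x| ^+ 2 = x ^+ 2.
Proof. by rewrite real_normK ?num_real. Qed.

(** The nearest point of the box is found by clipping each coordinate, at
    distance [excess]. *)
Lemma parallel_centered_box c n (t : R) (x : 'rV[R]_n) :
  (forall i, 0 <= c i) -> 0 <= t ->
  parallel_body (centered_box c n) t x <->
  \sum_(i < n) excess (c i) (x 0 i) ^+ 2 <= t ^+ 2.
Proof.
move=> c0 t0; split.
  move=> [v hv] [b hb] <-.
  apply: (@le_trans _ _ (t ^+ 2 * \sum_(i < n) `|b 0 i| ^+ 2)); last first.
    by rewrite ler_piMr ?sqr_ge0.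
  rewrite mulr_sumr; apply: ler_sum => i _; rewrite -exprMn.
  rewrite ler_sqr ?nnegrE ?excess_ge0 ?mulr_ge0// /excess ge_max mulr_ge0// andbT.
  rewrite !mxE lerBlDr; apply: le_trans (ler_normD _ _) _.
  by rewrite normrM (ger0_norm t0) addrC lerD2l hv.
move=> hx.
(* x - e is the clipped point. *)
pose e i := Num.sg (x 0 i) * excess (c i) (x 0 i).
have e2 i : e i ^+ 2 = excess (c i) (x 0 i) ^+ 2.
  rewrite /e exprMn sqr_sg; have [->|_] := eqVneq (x 0 i) 0; last by rewrite mul1r.
  by rewrite /excess normr0 sub0r max_r ?oppr_le0// expr0n mulr0.
exists (\row_i (x 0 i - e i)).
  move=> i; rewrite mxE /e {1}[x 0 i]numEsg -mulrBr normrM.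
  apply: (@le_trans _ _ `| `|x 0 i| - excess (c i) (x 0 i)|).
    rewrite ler_piMl//; case: sgrP => _; rewrite ?normr0 ?normrN ?normr1 ?ler01//.
  rewrite /excess; have [h|h] := leP (`|x 0 i| - c i) 0.
    by rewrite subr0 normr_id -subr_le0.
  by rewrite opprB addrC subrK ger0_norm.
(* For t = 0 the quotient e / t is 0, which is right as e = 0. *)
have te i : t = 0 -> e i = 0.
  move=> t00; apply/eqP; rewrite -sqrf_eq0 e2 eq_le sqr_ge0 andbT.
  apply: le_trans (_ : _ <= t ^+ 2) _; last by rewrite t00 expr0n.
  by apply: le_trans hx; rewrite (bigD1 i)//= lerDl sumr_ge0// => j _; rewrite sqr_ge0.
exists (\row_i (e i / t)).
  rewrite /unit_ball /=.
  under eq_bigr do rewrite mxE sqr_norm expr_div_n e2.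
  rewrite -mulr_suml; have [->|tn0] := eqVneq t 0; first by rewrite expr0n invr0 mulr0.
  by rewrite ler_pdivrMr ?mul1r// exprn_gt0// lt0r tn0.
apply/rowP => i; rewrite !mxE; have [t00|tn0] := eqVneq t 0.
  by rewrite te// t00 mul0r subr0 addr0.
by rewrite mulrCA divff// mulr1 subrK.
Qed.

Lemma is_minkowski_poly_box c n : (forall i, 0 <= c i) ->
  is_minkowski_poly (centered_box c n) (box_poly c n).
Proof.
move=> c0 t t0; rewrite -lebesgue_box_nbhd// /vol; congr (leb n _).
apply/seteqP; split => u /=.
  move/(parallel_centered_box _ c0 t0).
  by rewrite /box_nbhd /=; under eq_bigr do rewrite mxE.
move=> hu; apply/(parallel_centered_box _ c0 t0).
by under eq_bigr do rewrite mxE.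
Qed.

Lemma unit_cubeE n :
  unit_cube R n = centered_box (fun i => (i < n)%:R) n.
Proof.
apply/seteqP; split => x; rewrite /unit_cube /centered_box /=.
  by move=> /bigmax_leP[_ h] i; rewrite ltn_ord; exact: h.
by move=> h; apply/bigmax_leP; split => // i _; have := h i; rewrite ltn_ord.
Qed.

Lemma squeezed_cubeE n :
  squeezed_cylinder (unit_cube R n) = centered_box (fun i => (i < n)%:R) (n + 1).
Proof.
rewrite unit_cubeE; apply/seteqP; split => x.
  move=> [y hy <-] i; rewrite mxE /=; case: splitP => j /= ij.
    by have := hy j; rewrite ltn_ord.
  by rewrite mxE normr0 ler0n.
move=> hx; exists (lsubmx x).
  by move=> i; have := hx (lshift 1 i); rewrite mxE.
rewrite -[RHS]hsubmxK; congr row_mx; apply/rowP => i; rewrite !mxE.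
by have := hx (rshift n i); rewrite /= ltnNge leq_addr /= normr_le0 => /eqP.
Qed.

(** The triangle inequality for the Euclidean norm. *)
Lemma sum_sqr_addr (I : finType) (v w : I -> R) (a b : R) : 0 <= a -> 0 <= b ->
  \sum_i v i ^+ 2 <= a ^+ 2 -> \sum_i w i ^+ 2 <= b ^+ 2 ->
  \sum_i (v i + w i) ^+ 2 <= (a + b) ^+ 2.
Proof.
move=> a0 b0 hv hw.
have zero (u : I -> R) : \sum_i u i ^+ 2 <= 0 -> forall i, u i = 0.
  move=> h i; apply/eqP; rewrite -sqrf_eq0 eq_le sqr_ge0 andbT.
  apply: le_trans h; rewrite (bigD1 i)//= lerDl.
  by apply: sumr_ge0 => j _; rewrite sqr_ge0.
have -> : \sum_i (v i + w i) ^+ 2 =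
    \sum_i v i ^+ 2 + 2 * (\sum_i v i * w i) + \sum_i w i ^+ 2.
  rewrite mulr_sumr -!big_split /=; apply: eq_bigr => i _; ring.
suff : \sum_i v i * w i <= a * b by nra.
have [aE|an0] := eqVneq a 0.
  rewrite big1 ?aE ?mul0r// => i _; rewrite zero ?mul0r//.
  by move: hv; rewrite aE expr0n.
have [bE|bn0] := eqVneq b 0.
  rewrite big1 ?bE ?mulr0// => i _; rewrite [w i]zero ?mulr0//.
  by move: hw; rewrite bE expr0n.
have ab : 0 < a * b by rewrite mulr_gt0// lt0r ?an0 ?bn0.
have : 0 <= \sum_i (b * v i - a * w i) ^+ 2 by apply: sumr_ge0 => i _; rewrite sqr_ge0.
have -> : \sum_i (b * v i - a * w i) ^+ 2 = b ^+ 2 * (\sum_i v i ^+ 2)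
    - 2 * (a * b) * (\sum_i v i * w i) + a ^+ 2 * (\sum_i w i ^+ 2).
  rewrite !mulr_sumr -sumrB -!big_split /=; apply: eq_bigr => i _; ring.
move=> h; rewrite -(ler_pM2l ab).
have h1 : b ^+ 2 * (\sum_i v i ^+ 2) <= b ^+ 2 * a ^+ 2 by rewrite ler_wpM2l ?sqr_ge0.
have h2 : a ^+ 2 * (\sum_i w i ^+ 2) <= a ^+ 2 * b ^+ 2 by rewrite ler_wpM2l ?sqr_ge0.
move: h h1 h2; set A := b ^+ 2 * _; set B := a ^+ 2 * _.
have -> : a * b * (a * b) = b ^+ 2 * a ^+ 2 by ring.
have -> : a ^+ 2 * b ^+ 2 = b ^+ 2 * a ^+ 2 by ring.
by set Cc := _ ^+ 2 * _ ^+ 2; set S := \sum_i _; lra.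
Qed.

Lemma excess0 (x : R) : excess 0 x = `|x|.
Proof. by rewrite /excess subr0 max_l. Qed.

(** In the converse direction, x = v + t v with v = x / (1 + t). *)
Lemma parallel_unit_ball n (t : R) (x : 'rV[R]_n) : 0 <= t ->
  parallel_body (unit_ball R n) t x <-> \sum_(i < n) x 0 i ^+ 2 <= (1 + t) ^+ 2.
Proof.
move=> t0; split.
  move=> [v hv] [b hb] <-.
  under eq_bigr do rewrite !mxE.
  apply: (@sum_sqr_addr _ (v 0) (fun i => t * b 0 i)) => //.
    by move: hv; rewrite /unit_ball /= expr1n; under eq_bigr do rewrite sqr_norm.
  under eq_bigr do rewrite exprMn -[b 0 _ ^+ 2]sqr_norm.
  rewrite -mulr_sumr.
  by rewrite ler_piMr ?sqr_ge0.
move=> hx; have t1 : 0 < 1 + t by rewrite ltr_wpDr.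
have hb : unit_ball R n ((1 + t)^-1 *: x).
  rewrite /unit_ball /=.
  under eq_bigr do rewrite mxE sqr_norm exprMn.
  by rewrite -mulr_sumr exprVn mulrC ler_pdivrMr ?exprn_gt0// mul1r.
exists ((1 + t)^-1 *: x) => //; exists ((1 + t)^-1 *: x) => //.
rewrite -[X in X + _]scale1r -scalerDl scalerA divff ?scale1r//.
exact: lt0r_neq0.
Qed.

Lemma is_minkowski_poly_unit_ball n :
  is_minkowski_poly (unit_ball R n) (box_poly (cst 0) n \Po (1 + 'X)).
Proof.
move=> t t0; rewrite horner_comp hornerD hornerX hornerC.
rewrite -lebesgue_box_nbhd ?addr_ge0// /vol; congr (leb n _).
apply/seteqP; split => u /=.
  move/(parallel_unit_ball _ t0); rewrite /box_nbhd /=.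
  under eq_bigr do rewrite mxE.
  by under [in X in _ -> X]eq_bigr do rewrite excess0 sqr_norm.
rewrite /box_nbhd /= => hu; apply/(parallel_unit_ball _ t0).
under eq_bigr do rewrite mxE -sqr_norm -excess0.
exact: hu.
Qed.

(** The displacement spends |s| of its length t on the last coordinate and
    keeps rho = sqrt (t^2 - s^2) for the others, which therefore fill the ball
    of radius 1 + rho. *)
Lemma parallel_squeezed_ball n (t : R) (x : 'rV[R]_(n + 1)) : 0 <= t ->
  parallel_body (squeezed_cylinder (unit_ball R n)) t x <->
  x 0 (rshift n 0) ^+ 2 <= t ^+ 2 /\
  \sum_(i < n) x 0 (lshift 1 i) ^+ 2 <=
    (1 + Num.sqrt (t ^+ 2 - x 0 (rshift n 0) ^+ 2)) ^+ 2.
Proof.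
move=> t0; split.
  move=> [_ [v hv <-]] [b hb] <-.
  rewrite !mxE (unsplitK (inr 0)) /= mxE add0r exprMn.
  have {}hb : \sum_(i < n) b 0 (lshift 1 i) ^+ 2 + b 0 (rshift n 0) ^+ 2 <= 1.
    move: hb; rewrite /unit_ball /= big_split_ord big_ord1 /= sqr_norm.
    by under eq_bigr do rewrite sqr_norm.
  have b0 : 0 <= \sum_(i < n) b 0 (lshift 1 i) ^+ 2.
    by apply: sumr_ge0 => i _; rewrite sqr_ge0.
  have bt : t ^+ 2 * b 0 (rshift n 0) ^+ 2 <= t ^+ 2.
    by rewrite ler_piMr ?sqr_ge0//; lra.
  split => //.
  under eq_bigr => i _ do rewrite !mxE (unsplitK (inl i)) /=.
  apply: (@sum_sqr_addr _ (v 0) (fun i => t * b 0 (lshift 1 i))) => //.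
    by move: hv; rewrite /unit_ball /= expr1n; under eq_bigr do rewrite sqr_norm.
  under eq_bigr do rewrite exprMn.
  rewrite -mulr_sumr sqr_sqrtr ?subr_ge0// -[X in _ <= X - _]mulr1 -mulrBr.
  by rewrite ler_wpM2l ?sqr_ge0// lerBrDr.
move=> [hs hy]; set s := x 0 (rshift n 0) in hs hy *.
set rho := Num.sqrt _ in hy.
have rho2 : rho ^+ 2 = t ^+ 2 - s ^+ 2 by rewrite sqr_sqrtr ?subr_ge0.
have rho0 : 0 <= rho by exact: sqrtr_ge0.
have rho1 : 0 < 1 + rho by rewrite ltr_wpDr.
have hv : unit_ball R n ((1 + rho)^-1 *: lsubmx x).
  rewrite /unit_ball /=.
  under eq_bigr do rewrite !mxE sqr_norm exprMn.
  by rewrite -mulr_sumr exprVn mulrC ler_pdivrMr ?exprn_gt0// mul1r.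
have t00 : t = 0 -> s = 0 /\ rho = 0.
  move=> tE; have s0 : s = 0.
    by apply/eqP; rewrite -sqrf_eq0 eq_le sqr_ge0 andbT; move: hs; rewrite tE expr0n.
  by split => //; apply/eqP; rewrite -sqrf_eq0 rho2 s0 tE subrr.
exists (row_mx ((1 + rho)^-1 *: lsubmx x) 0); first by exists ((1 + rho)^-1 *: lsubmx x).
exists (row_mx ((rho / t) *: ((1 + rho)^-1 *: lsubmx x)) (const_mx (s / t))).
  rewrite /unit_ball /= big_split_ord big_ord1 /=.
  rewrite row_mxEr mxE sqr_norm.
  under eq_bigr do rewrite row_mxEl mxE normrM exprMn sqr_norm.
  rewrite -mulr_sumr.
  apply: (@le_trans _ _ ((rho / t) ^+ 2 + (s / t) ^+ 2)).
    by rewrite lerD2r ler_piMr ?sqr_ge0.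
  have [/[dup] tE /t00[-> ->]|tn0] := eqVneq t 0; first by rewrite !mul0r expr0n addr0.
  by rewrite !expr_div_n rho2 -mulrDl subrK divff// expf_neq0.
rewrite scale_row_mx add_row_mx add0r -[RHS]hsubmxK; congr row_mx.
  rewrite scalerA -[X in X + _]scale1r -scalerDl scalerA.
  have -> : t * (rho / t) = rho.
    have [/[dup] tE /t00[_ ->]|tn0] := eqVneq t 0; first by rewrite mul0r mulr0.
    by rewrite mulrCA divff// mulr1.
  by rewrite divff ?scale1r// lt0r_neq0.
apply/rowP => i; rewrite !mxE ord1 -/s.
have [/[dup] tE /t00[-> _]|tn0] := eqVneq t 0; first by rewrite mul0r mulr0.
by rewrite mulrCA divff// mulr1.
Qed.

(** * Minkowski polynomials *)

Definition squeezed_ball_nbhd n (t : R) (x : nat -> R) : Prop :=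
  x n ^+ 2 <= t ^+ 2 /\
  \sum_(i < n) x i ^+ 2 <= (1 + Num.sqrt (t ^+ 2 - x n ^+ 2)) ^+ 2.

Lemma measurable_nth n (i : 'I_n) :
  measurable_fun [set: n.-tuple T] (fun u => nth (0 : R) u i).
Proof.
rewrite (_ : (fun _ => _) = (fun u : n.-tuple T => tnth u i)).
  exact: measurable_tnth.
by apply/funext => u; rewrite (tnth_nth (0 : R)).
Qed.

Lemma measurable_squeezed_ball_nbhd n t :
  measurable [set u : n.+1.-tuple T | squeezed_ball_nbhd n t (nth (0 : R) u)].
Proof.
pose f (u : n.+1.-tuple T) : R := nth (0 : R) u n ^+ 2.
pose g (u : n.+1.-tuple T) : R := \sum_(i < n) nth (0 : R) u i ^+ 2.
pose h (x : R) : R := (1 + Num.sqrt (t ^+ 2 - x)) ^+ 2.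
have mf : measurable_fun setT f.
  by apply: measurable_funX; exact: (measurable_nth ord_max).
have mg : measurable_fun setT g.
  apply: measurable_sum => i; apply: measurable_funX.
  exact: (measurable_nth (widen_ord (leqnSn n) i)).
have ch : continuous h.
  move=> x; apply: (@continuous_comp R R R (fun x => 1 + Num.sqrt (t ^+ 2 - x))
    (fun y => y ^+ 2)).
    apply: continuousD; first exact: cvg_cst.
    apply: (@continuous_comp R R R (fun x => t ^+ 2 - x) Num.sqrt).
      by apply: continuousB; [exact: cvg_cst|exact: cvg_id].
    exact: sqrt_continuous.
  exact: exprn_continuous.
have mh : measurable_fun setT (h \o f).
  by apply: measurableT_comp => //; exact: continuous_measurable_fun.
have mle (a b : n.+1.-tuple T -> R) : measurable_fun setT a ->
    measurable_fun setT b -> measurable [set u | a u <= b u].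
  by move=> ma mb; rewrite -[X in measurable X]setTI; exact: measurable_fun_le.
apply: measurableI; first exact: mle mf (measurable_cst _).
exact: mle mg mh.
Qed.

(** The slice at height s of the parallel body is the ball of radius 1 + sqrt
    (t^2 - s^2). *)
Lemma is_minkowski_poly_squeezed_ball n :
  is_minkowski_poly (squeezed_cylinder (unit_ball R n))
    (slice_poly (box_poly (cst 0) n \Po (1 + 'X))).
Proof.
move=> t t0; set p := _ \Po _.
have -> : slice_poly p = (2 * 0) *: p + slice_poly p.
  by rewrite mulr0 scale0r add0r.
rewrite -integral_slice// /vol.
transitivity (leb (n + 1)
    [set u | squeezed_ball_nbhd n t (nth (0 : R) u)]).
  congr (leb _ _); apply/seteqP; split => u /=.
    move/(parallel_squeezed_ball _ t0); rewrite !mxE !(tnth_nth (0 : R)) /= addn0.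
    by under eq_bigr do rewrite mxE (tnth_nth (0 : R)) /=.
  move=> hu; apply/(parallel_squeezed_ball _ t0).
  rewrite !mxE !(tnth_nth (0 : R)) /= addn0.
  by under eq_bigr do rewrite mxE (tnth_nth (0 : R)) /=.
rewrite addn1 lebesgue_tuple_slice_last; last exact: measurable_squeezed_ball_nbhd.
apply: eq_integral => s _.
pose slice := [set u : n.-tuple T | (s : R) ^+ 2 <= t ^+ 2 /\
  \sum_(i < n) tnth u i ^+ 2 <= (1 + Num.sqrt (t ^+ 2 - (s : R) ^+ 2)) ^+ 2].
rewrite [X in leb n X](_ : _ = slice); last first.
  apply/funext => u; rewrite /slice /squeezed_ball_nbhd /=.
  rewrite nth_rcons size_tuple ltnn eqxx.
  by under eq_bigr do rewrite nth_rcons size_tuple ltn_ord -tnth_nth.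
rewrite /slice_fun add0r excess0 sqr_norm.
have -> : (`|s : R| <= t) = ((s : R) ^+ 2 <= t ^+ 2).
  by rewrite -[(s : R) ^+ 2]sqr_norm ler_sqr ?nnegrE.
case: ifPn => hs.
  rewrite horner_comp hornerD hornerX hornerC -lebesgue_box_nbhd//.
  congr (leb n _); rewrite /slice; apply/seteqP; split => u /=.
    move=> [_]; rewrite /box_nbhd /=.
    by under [in X in _ -> X]eq_bigr do rewrite excess0 sqr_norm.
  rewrite /box_nbhd /= => hu; split => //.
  by under eq_bigr do rewrite -sqr_norm -excess0.
rewrite [X in leb n X](_ : _ = set0) ?measure0//; apply/seteqP; split => u //= [h].
by rewrite h in hs.
Qed.

Lemma coef_slice_poly p k : (slice_poly p)`_k = if k is j.+1 then p`_j * wallis j else 0.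
Proof.
rewrite /slice_poly coefXM; case: k => //= k; rewrite coef_poly.
by case: ltnP => // h; rewrite nth_default// mul0r.
Qed.

Lemma slice_polyZ a p : slice_poly (a *: p) = a *: slice_poly p.
Proof.
by apply/polyP => -[|k]; rewrite coefZ !coef_slice_poly ?mulr0// coefZ mulrA.
Qed.

Lemma box_poly0 n : box_poly (cst 0) n = kappa n *: 'X^n.
Proof.
elim: n => [|n IH]; first by rewrite /= /kappa big_ord0 scale1r.
rewrite /= -/(cst 0) (_ : cst 0 \o succn = cst 0)// IH mulr0 scale0r add0r.
rewrite slice_polyZ kappaS -scalerA; congr (_ *: _).
apply/polyP => -[|k]; rewrite coef_slice_poly coefZ coefXn ?mulr0//.
by rewrite coefXn eqSS; case: eqP => [->|_]; rewrite ?mul1r ?mulr1 ?mul0r ?mulr0.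
Qed.

(** Each unit half-side acts on polynomials as 2 + S, where S is [slice_poly]
    and S^k 1 = kappa k X^k; this is the binomial expansion of (2 + S)^n S^m 1,
    in the form of Pascal's rule. *)
Lemma box_poly_cube n m :
  box_poly (fun i => (i < n)%:R) (n + m) = 'X^m * steiner_poly n m.
Proof.
elim: n => [|n IH].
  rewrite add0n (_ : (fun i : nat => _) = cst 0)// box_poly0.
  rewrite -mul_polyC mulrC; congr (_ * _).
  apply/polyP => -[|k]; rewrite coefC coef_poly //=.
  by rewrite bin0 expr0 !mul1r.
rewrite addSn /=.
have -> : ((fun i => (i < n.+1)%N%:R) \o succn) = (fun i => (i < n)%N%:R : R) by [].
rewrite IH mulr1.
have coef_steiner l k : (steiner_poly l m)`_k =
    'C(l, k)%:R * 2 ^+ (l - k) * kappa (k + m).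
  by rewrite coef_poly ltnS; case: leqP => // lk; rewrite bin_small// !mul0r.
apply/polyP => k; rewrite coefD coefZ coef_slice_poly !coefXnM.
have [km|mk] := ltnP k m.
  by case: k km => [|k] km; rewrite ?mulr0 ?addr0// coefXnM (ltnW km) mul0r addr0.
rewrite -(subnK mk); move: (k - m)%N => {mk}k; rewrite !addnK !coef_steiner.
case: k => [|k].
  rewrite !bin0 !subn0 !mul1r mulrA -exprS.
  rewrite add0n.
  case: m {IH coef_steiner} => [|l]; first by rewrite addr0.
  by rewrite ?addr0// coefXnM ltnSn mul0r addr0.
rewrite addSn coefXnM ltnNge leq_addl /= addnK coef_steiner binS natrD subSS.
rewrite kappaS.
have [kn|nk] := ltnP k n; last by rewrite bin_small// !mul0r; ring.
by rewrite -(subnSK kn) exprS; ring.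
Qed.

Lemma is_minkowski_poly_cube n :
  is_minkowski_poly (unit_cube R n) (steiner_poly n 0).
Proof.
have := box_poly_cube n 0; rewrite expr0 mul1r addn0 unit_cubeE => <-.
exact: is_minkowski_poly_box.
Qed.

Lemma is_minkowski_poly_squeezed_cube n :
  is_minkowski_poly (squeezed_cylinder (unit_cube R n)) ('X * steiner_poly n 1).
Proof.
by rewrite squeezed_cubeE -['X]expr1 -box_poly_cube; exact: is_minkowski_poly_box.
Qed.

Lemma unit_ball_polyE n : box_poly (cst 0) n \Po (1 + 'X) =
  kappa n *: \prod_(r <- nseq n (-1)) ('X - r%:P) :> {poly R}.
Proof.
rewrite box_poly0 comp_polyZ comp_Xn_poly big_nseq iter_mulr_1.
by rewrite polyCN opprK addrC.
Qed.

Lemma squeezed_ball_polyE n : slice_poly (box_poly (cst 0) n \Po (1 + 'X)) =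
  'X * (kappa n *: ball_poly n) :> {poly R}.
Proof.
rewrite box_poly0 comp_polyZ comp_Xn_poly slice_polyZ -scalerAr; congr (_ *: _).
apply/polyP => -[|k]; rewrite coef_slice_poly coefXM//= coef_poly ltnS.
rewrite exprDn coef_sum.
have [kn|nk] := leqP k n; last first.
  rewrite big1 ?mul0r// => i _; rewrite expr1n mul1r coefMn coefXn.
  by rewrite gtn_eqF ?mul0rn// (leq_trans (ltn_ord i)).
rewrite (bigD1 (Ordinal (kn : (k < n.+1)%N)))//= expr1n mul1r coefMn coefXn eqxx.
rewrite big1 ?addr0// => i ik; rewrite expr1n mul1r coefMn coefXn.
by rewrite eq_sym (negPf (_ : (i : nat) != k)) ?mul0rn.
Qed.

End MinkowskiPolynomials.

Theorem theorem2p4 (R : realType) :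
  (forall n : nat, (1 <= n)%N ->
     dissipative (minkowski_poly (unit_ball R n)) /\
     all_roots_negative (minkowski_poly (unit_ball R n))) /\
  ((forall n : nat, (1 <= n)%N ->
      exists D : {poly R},
        minkowski_poly (squeezed_cylinder (unit_ball R n)) = 'X * D /\
        dissipative D) /\
   (exists n0 : nat, forall n : nat, (n0 <= n)%N -> (1 <= n)%N ->
      has_nonreal_root
        (minkowski_poly (squeezed_cylinder (unit_ball R n))))) /\
  (forall n : nat, (1 <= n)%N ->
     dissipative (minkowski_poly (unit_cube R n)) /\
     all_roots_negative (minkowski_poly (unit_cube R n))) /\
  (forall n : nat, (1 <= n)%N ->
     exists D : {poly R},
       minkowski_poly (squeezed_cylinder (unit_cube R n)) = 'X * D /\
       dissipative D /\ all_roots_negative D).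
Proof.
have neg n m : all_roots_negative (steiner_poly R n m).
  exact: steiner_poly_all_roots_negative.
have k0 n : kappa R n != 0 by rewrite gt_eqF// kappa_gt0.
split; [|split; [split|split]].
- move=> n _; suff h : all_roots_negative (minkowski_poly (unit_ball R n)).
    by split => //; exact: all_roots_negative_dissipative.
  rewrite (minkowski_polyE (@is_minkowski_poly_unit_ball R n)) unit_ball_polyE => z.
  move=> /complex_root_prod[//|r]; rewrite mem_nseq => /andP[_ /eqP ->] -> /=.
  by rewrite ltrN10.
- move=> n _; exists (kappa R n *: ball_poly R n); split.
    rewrite (minkowski_polyE (@is_minkowski_poly_squeezed_ball R n)).
    by rewrite squeezed_ball_polyE.
  by move=> z; rewrite complex_rootZ//; exact: dissipative_ball_poly.
- have [n0 hn0] := @ball_poly_nonreal_root R.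
  exists n0 => n n0n _; have [z [rz Iz]] := hn0 n n0n; exists z; split => //.
  rewrite (minkowski_polyE (@is_minkowski_poly_squeezed_ball R n)) squeezed_ball_polyE.
  by rewrite /complex_root rmorphM rootM -!/(complex_root _ _) complex_rootZ// rz orbT.
- move=> n _; rewrite (minkowski_polyE (@is_minkowski_poly_cube R n)).
  by split => //; exact: all_roots_negative_dissipative.
- move=> n _; exists (steiner_poly R n 1); split.
    by rewrite (minkowski_polyE (@is_minkowski_poly_squeezed_cube R n)).
  by split => //; exact: all_roots_negative_dissipative.
Qed.
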